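(* Let $(\nu(i))_{i\ge0}$ be a positive decreasing sequence such that $\sum_{i=0}^{\infty}\sqrt{\nu(i)/(i+1)}<\infty$ and $E((f(X_{i,m})-f(X_i))^2)\le \nu(i)$ for all integers $i,m\ge 0$. For $j\ge0$ put $\overline{\nu}(j)=\sum_{i=j}^{\infty}\sqrt{\nu(i)/(i+1)}$, and let $\mu=\lim_{h\to\infty}E(f(X_h))$ (which exists and is finite under these hypotheses). Let $k\ge1$, and let $$p_l=\frac{\overline{\nu}(k2^{l-2})-\overline{\nu}(k2^{l-1})}{2^l\,\overline{\nu}(k)}\ (l\ge2),\qquad p_1=\frac13\Big(1-\sum_{l=2}^\infty p_l\Big),\qquad p_0=2p_1,\qquad q=\frac{\overline{\nu}(\lfloor b'(k)/2\rfloor)}{\overline{\nu}(0)} .$$ Let $\hat f_k$ be the estimator built from $(p_l)_{l\ge0}$ and $q$, and $\hat T_k$ its expected simulation time. Then $\hat f_k$ is square-integrable, $E(\hat f_k)=\mu$, $\hat T_k\le k+9qk$, and $$\hat T_k\operatorname{Var}(\hat f_k)\le k\operatorname{Var}(f_k)+8610\,(\overline{\nu}(0))^2\max\left(q,\sqrt{\frac{b'(k)-b(k)}{k}}\right).$$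
   Context: Setting: $F,F'$ are measurable spaces, $g:F\times F'\to F$ is measurable, $(U_i)_{i\in\mathbb Z}$ are i.i.d. $F'$-valued random variables, $X_0\in F$ is deterministic, and $X_{i+1}=g(X_i,U_i)$ for $i\ge0$. The function $f:F\to\mathbb R$ is measurable and $f(X_i)$ is square-integrable for every $i\ge0$. For $m\in\mathbb Z$, $(X_{i,m})_{i\ge -m}$ is defined by $X_{-m,m}=X_0$ and $X_{i+1,m}=g(X_{i,m},U_i)$ for $i\ge -m$; in particular $X_{i,0}=X_i$ for $i\ge0$. Estimators: for $k\ge1$ fix integers $0\le b(k)\le b'(k)\le k/2$ and set $$f_k=\frac1{k-b(k)}\sum_{i=b(k)}^{k-1}f(X_i),\qquad f_{k,l}=\frac1{k-b'(k)}\sum_{i=b'(k)}^{k-1}f(X_{i,k(2^l-1)})\quad(l\ge0).$$ Given a probability distribution $(p_l)_{l\ge0}$ on the non-negative integers with all $p_l>0$, let $N$ be independent of $(U_i)_{i\in\mathbb Z}$ with $\Pr(N=l)=p_l$, and $Z_k=(f_{k,N+1}-f_{k,N})/p_N$. Given $q\in(0,1]$, let $Z'_k$ be a copy of $Z_k$ independent of $f_{k,0}$, let $Q\in\{0,1\}$ be independent of $(f_{k,0},Z'_k)$ with $\Pr(Q=1)=q$, and set $\hat f_k=f_{k,0}+q^{-1}QZ'_k$. Cost model: simulating $f_k$ takes expected time $k$, and simulating $f_{k,l}$ takes expected time $k2^l$, so the expected time $\tau_{k,l}$ to simulate $f_{k,l+1}-f_{k,l}$ satisfies $\tau_{k,l}\le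 k2^{l+1}+k2^l=3k2^l$. The expected time to simulate $Z_k$ is $T_k=\sum_{l\ge0}p_l\tau_{k,l}$, and the expected time to simulate $\hat f_k$ is $\hat T_k=k+qT_k$. *)

(* Defs.v *)
From HB Require Import structures.
From mathcomp Require Import all_boot all_order all_algebra.
From mathcomp Require Import all_classical all_reals all_analysis.

Set Implicit Arguments.
Unset Strict Implicit.
Unset Printing Implicit Defensive.

Import Order.TTheory GRing.Theory Num.Theory.
Import numFieldNormedType.Exports.

Local Open Scope classical_set_scope.
Local Open Scope ring_scope.

Section independence.
Context d (T : measurableType d) (R : realType) (P : probability T R).

Definition indep_systems (G H : set (set T)) : Prop :=
  forall A B, G A -> H B -> P (A `&` B) = (P A * P B)%E.

Definition indep_RV d1 (T1 : measurableType d1) d2 (T2 : measurableType d2)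
    (X : T -> T1) (Y : T -> T2) : Prop :=
  indep_systems (g_sigma_algebra_preimage X) (g_sigma_algebra_preimage Y).

Definition sigma_family (I : Type) d' (T' : measurableType d')
    (X : I -> T -> T') : set (set T) :=
  <<s \bigcup_i g_sigma_algebra_preimage (X i) >>.

Definition indep_RV_family (I : Type) d1 (T1 : measurableType d1)
    d2 (T2 : measurableType d2) (Y : T -> T1) (X : I -> T -> T2) : Prop :=
  indep_systems (g_sigma_algebra_preimage Y) (sigma_family X).

Definition mutually_indep (I : eqType) d' (T' : measurableType d')
    (X : I -> T -> T') : Prop :=
  forall (s : seq I) (A : I -> set T'), uniq s ->
    (forall i, measurable (A i)) ->
    P (\big[setI/setT]_(i <- s) (X i @^-1` A i)) =
    (\prod_(i <- s) P (X i @^-1` A i))%E.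

(* The two laws are compared on measurable sets only: outside of them the
   values of P are unspecified, so an equation between the pushforward
   functions themselves would be too strong. *)
Definition same_law d' (T' : measurableType d') (X Y : T -> T') : Prop :=
  forall A, measurable A -> P (X @^-1` A) = P (Y @^-1` A).

Definition iid (I : eqType) d' (T' : measurableType d')
    (X : I -> T -> T') : Prop :=
  mutually_indep X /\ forall i j, same_law (X i) (X j).

End independence.

Section chain.
Context (F F' T : Type) (R : realType).
Variables (g : F * F' -> F) (U : int -> T -> F') (x0 : F).

(* The chain started from x0 at time -m, after n steps, i.e. at time n - m. *)
Fixpoint chain_steps (m : int) (n : nat) (w : T) : F :=
  if n is n'.+1 then g (chain_steps m n' w, U (n'%:Z - m) w) else x0.

(* X_{i,m}; only meaningful for - m <= i, where `|i + m| is i + m. *)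
Definition chain (i m : int) : T -> F := chain_steps m `|(i + m)%R|%N.

Variables (f : F -> R).

Definition time_avg (b k : nat) (m : int) (w : T) : R :=
  (k - b)%:R^-1 * \sum_(b <= i < k) f (chain i%:Z m w).

Variables (b b' : nat -> nat).

Definition f_avg (k : nat) : T -> R := time_avg (b k) k 0.

Definition f_level (k l : nat) : T -> R :=
  time_avg (b' k) k (k * (2 ^ l - 1))%N%:Z.

Definition Z_est (p : nat -> R) (N : T -> nat) (k : nat) (w : T) : R :=
  (f_level k (N w).+1 w - f_level k (N w) w) / p (N w).

Definition unbiased_est (q : R) (Z' : T -> R) (Q : T -> bool) (k : nat)
    (w : T) : R :=
  f_level k 0 w + q^-1 * (Q w)%:R * Z' w.

End chain.

Section parameters.
Context (R : realType).
Variable nu : nat -> R.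

Definition nu_term (i : nat) : R := Num.sqrt (nu i / i.+1%:R).

Definition nubar (j : nat) : R := \big[+%R/0]_(j <= i <oo) nu_term i.

Definition p_tail (k l : nat) : R :=
  (nubar (k * 2 ^ (l - 2)) - nubar (k * 2 ^ (l - 1))) / (2 ^+ l * nubar k).

Definition p_one (k : nat) : R :=
  3^-1 * (1 - \big[+%R/0]_(2 <= l <oo) p_tail k l).

Definition p_dist (k l : nat) : R :=
  match l with
  | 0 => 2 * p_one k
  | 1 => p_one k
  | _ => p_tail k l
  end.

Definition q_prob (b' : nat -> nat) (k : nat) : R :=
  nubar (b' k)./2 / nubar 0.

End parameters.

Section cost.
Context (R : realType).

(* Expected time to simulate f_level k l. *)
Definition level_cost (k l : nat) : R := k%:R * 2 ^+ l.

(* tau k l is the expected time to simulate f_level k l.+1 - f_level k l. *)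
Variables (p : nat -> R) (tau : nat -> nat -> R).

Definition Z_time (k : nat) : \bar R :=
  (\sum_(0 <= l <oo) (p l * tau k l)%:E)%E.

Definition est_time (q : R) (k : nat) : \bar R :=
  (k%:R%:E + q%:E * Z_time k)%E.

End cost.

(* Main.v *)
(* The mean of f(X_i) is within sqrt(nu(h)) of its limit for i >= h, which makes
   the telescoping sum over the levels unbiased.  For the variances, restarting
   the chain at an intermediate time gives a block that is independent of the
   past, at an L2 cost of sum_i sqrt(nu(i)); repeated doubling of the block
   length then bounds the standard deviation of a sum of n consecutive f(X_i) by
   5 nubar(0) sqrt(n).  The same L2 comparison bounds the second moment of the
   l-th difference by nu(k 2^(l-1)), and (nubar(k 2^(l-2)) - nubar(k 2^(l-1)))^2
   dominates k 2^(l-1) nu(k 2^(l-1)) up to a constant, so that the weights p_l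
   turn the second moment of Z_k into a telescoping sum, at most
   32 q^2 nubar(0)^2 / k.  Finally, dropping the b' - b first terms changes the
   standard deviation of the average by O(nubar(0) sqrt(b' - b) / k). *)
Require Import Defs.
From HB Require Import structures.
From mathcomp Require Import all_boot all_order all_algebra.
From mathcomp Require Import all_classical all_reals all_analysis.
From mathcomp Require Import measurable_realfun ring lra zify.

Set Implicit Arguments.
Unset Strict Implicit.
Unset Printing Implicit Defensive.

Import Order.TTheory GRing.Theory Num.Theory.
Import numFieldNormedType.Exports.

Local Open Scope classical_set_scope.
Local Open Scope ring_scope.

(** * Joint laws of independent variables *)

Section independence.
Context d (T : measurableType d) (R : realType) (P : probability T R).

(** The hypothesis on [nu] only compares the chain started at a time -m <= 0 with the one started at
    0, whereas the variance argument restarts the chain at arbitrary, in particular positive, times.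
    This is why so much of the development is about laws: two chains driven by the same innovations
    have a joint law that depends only on the gap between their starting times and on the number of
    steps, so the L2 bound may be shifted in time. Independence of what happens before and after a
    restart comes from that of the innovations by a pi-system argument. The estimates themselves are
    about L2 norms and standard deviations, taken as real numbers; the triangle inequality for both
    then replaces any summation of covariances. In these estimates the chain is an abstract family
    [Y m n] known only through square-integrability, a deterministic start, the coupling bound, the
    factorisation of means across a restart and, where means are compared, their independence of the
    starting time. *)

Lemma indep_law_pair d1 (T1 : measurableType d1) d2 (T2 : measurableType d2)
    (X : {RV P >-> T1}) (Y : {RV P >-> T2}) (C : set (T1 * T2)) :
  indep_RV P X Y -> measurable C ->
  (distribution P X \x distribution P Y)%E C = P ((fun w => (X w, Y w)) @^-1` C).
Proof.
move=> XY mC.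
have mXY : measurable_fun setT (fun w => (X w, Y w)).
  exact: measurable_fun_pair.
pose XY' : {RV P >-> (T1 * T2)%type} :=
  HB.pack (fun w => (X w, Y w)) (isMeasurableFun.Build _ _ _ _ _ mXY).
apply: (product_measure_unique (m' := distribution P XY')) => // A B mA mB.
by apply: XY; [exists A => //|exists B => //]; exact: setTI.
Qed.

Lemma same_law_pair d1 (T1 : measurableType d1) d2 (T2 : measurableType d2)
    (X X' : {RV P >-> T1}) (Y Y' : {RV P >-> T2}) :
  indep_RV P X Y -> indep_RV P X' Y' -> same_law P X X' -> same_law P Y Y' ->
  same_law P (fun w => (X w, Y w)) (fun w => (X' w, Y' w)).
Proof.
move=> XY XY' XX' YY' C mC.
rewrite -(indep_law_pair XY mC) -(indep_law_pair XY' mC).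
apply: (product_measure_unique
  (m' := (distribution P X' \x distribution P Y')%E)) => // A B mA mB.
rewrite /= (product_measure1E (distribution P X') (distribution P Y') mA mB).
by congr (_ * _)%E; [exact/esym/XX'|exact/esym/YY'].
Qed.

Lemma ge0_same_law_integral d1 (T1 : measurableType d1) (X Y : {RV P >-> T1})
    (h : T1 -> \bar R) : same_law P X Y ->
  measurable_fun [set: T1] h -> (forall x, (0 <= h x)%E) ->
  (\int[P]_w h (X w) = \int[P]_w h (Y w))%E.
Proof.
move=> XY mh h0; rewrite -(ge0_integral_distribution X)//.
rewrite -(ge0_integral_distribution Y)//.
by apply: eq_measure_integral => A mA _; exact: XY.
Qed.

Lemma same_law_integrable d1 (T1 : measurableType d1) (X Y : {RV P >-> T1})
    (h : T1 -> \bar R) : same_law P X Y -> measurable_fun [set: T1] h ->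
  P.-integrable setT (h \o X) -> P.-integrable setT (h \o Y).
Proof.
move=> XY mh /integrableP[_ hX]; apply/integrableP; split.
  exact: measurableT_comp.
rewrite -(ge0_same_law_integral XY (h := fun x => `|h x|%E))//.
exact: measurableT_comp.
Qed.

Lemma same_law_integral d1 (T1 : measurableType d1) (X Y : {RV P >-> T1})
    (h : T1 -> \bar R) : same_law P X Y -> measurable_fun [set: T1] h ->
  P.-integrable setT (h \o X) ->
  (\int[P]_w h (X w) = \int[P]_w h (Y w))%E.
Proof.
move=> XY mh hX; rewrite -(integral_distribution (X := X))//.
rewrite -(integral_distribution (X := Y))//; last exact: same_law_integrable hX.
by apply: eq_measure_integral => A mA _; exact: XY.
Qed.

Lemma ge0_integral_indep d1 (T1 : measurableType d1) d2 (T2 : measurableType d2)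
    (X : {RV P >-> T1}) (Y : {RV P >-> T2}) (h : T1 * T2 -> \bar R) :
  indep_RV P X Y -> measurable_fun [set: T1 * T2] h -> (forall z, (0 <= h z)%E) ->
  (\int[P]_w h (X w, Y w) =
   \int[distribution P X]_x \int[distribution P Y]_y h (x, y))%E.
Proof.
move=> XY mh h0.
have mXY : measurable_fun setT (fun w => (X w, Y w)).
  exact: measurable_fun_pair.
pose XY' : {RV P >-> (T1 * T2)%type} :=
  HB.pack (fun w => (X w, Y w)) (isMeasurableFun.Build _ _ _ _ _ mXY).
rewrite -(ge0_integral_distribution XY') // -fubini_tonelli1//.
by apply: eq_measure_integral => C mC _; exact/esym/indep_law_pair.
Qed.

Lemma integral_indep d1 (T1 : measurableType d1) d2 (T2 : measurableType d2)
    (X : {RV P >-> T1}) (Y : {RV P >-> T2}) (h : T1 * T2 -> \bar R) :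
  indep_RV P X Y -> P.-integrable setT (fun w => h (X w, Y w)) ->
  measurable_fun [set: T1 * T2] h ->
  (\int[P]_w h (X w, Y w) =
   \int[distribution P X]_x \int[distribution P Y]_y h (x, y))%E.
Proof.
move=> XY ih mh.
have mXY : measurable_fun setT (fun w => (X w, Y w)).
  exact: measurable_fun_pair.
pose XY' : {RV P >-> (T1 * T2)%type} :=
  HB.pack (fun w => (X w, Y w)) (isMeasurableFun.Build _ _ _ _ _ mXY).
rewrite -(integral_distribution (X:=XY')) //.
rewrite integral12_prod_meas1.
  by apply: eq_measure_integral => C mC _; exact/esym/indep_law_pair.
apply/integrableP; split => //.
rewrite fubini_tonelli1//; last exact: measurableT_comp.
rewrite -(ge0_integral_indep XY (h := fun z => `|h z|%E))//.
  by case/integrableP : ih.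
exact: measurableT_comp.
Qed.

Lemma Lfun_measurable (X : T -> R) p : X \in Lfun P p -> measurable_fun setT X.
Proof. by rewrite inE => /andP[/[!inE]]. Qed.

(** Tonelli applied to |xy| shows that the product is integrable, which is what then allows Fubini
    to factor its mean. *)
Lemma expectation_indepM (X Y : T -> R) : X \in Lfun P 1 -> Y \in Lfun P 1 ->
  indep_RV P X Y ->
  (X * Y)%R \in Lfun P 1 /\ 'E_P[X * Y]%E = ('E_P[X] * 'E_P[Y])%E.
Proof.
move=> X1 Y1 XY.
have mX := Lfun_measurable X1; have mY := Lfun_measurable Y1.
pose X' : {RV P >-> R} := HB.pack X (isMeasurableFun.Build _ _ _ _ _ mX).
pose Y' : {RV P >-> R} := HB.pack Y (isMeasurableFun.Build _ _ _ _ _ mY).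
move/Lfun1_integrable : X1 => /[dup] iX /integrableP[_ X1].
move/Lfun1_integrable : Y1 => /[dup] iY /integrableP[_ Y1].
have mh : measurable_fun [set: R * R] (fun z => (z.1 * z.2)%:E).
  by apply/measurable_EFinP; apply: measurable_funM.
have iXY : P.-integrable setT (EFin \o (X * Y)).
  apply/integrableP; split.
    by apply/measurable_EFinP; exact: measurable_funM.
  rewrite (ge0_integral_indep (X := X') (Y := Y')
    (h := fun z => `|(z.1 * z.2)%:E|%E)) //=; last first.
    by apply/measurable_EFinP; apply: measurableT_comp => //; exact: measurable_funM.
  have mabs : measurable_fun [set: R] (fun y : R => `|y|%:E).
    by apply/measurable_EFinP; exact: normr_measurable.
  under eq_integral => x _.
    rewrite (_ : integral _ _ _ = (`|x|%:E * \int[P]_w `|Y w|%:E)%E); last first.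
      under eq_integral => y _ do rewrite normrM EFinM.
      rewrite ge0_integralZl// ?(ge0_integral_distribution Y' mabs)//.
    over.
  rewrite ge0_integralZr//; last exact: integral_ge0.
  rewrite (ge0_integral_distribution X' mabs)//.
  by apply: lte_mul_pinfty => //; rewrite ?ge0_fin_numE//;
    apply: integral_ge0 => y _; rewrite lee_fin.
split; first exact/Lfun1_integrable.
rewrite unlock (integral_indep (X := X') (Y := Y') (h := fun z => (z.1 * z.2)%:E)) //=.
have iY' : (distribution P Y').-integrable setT EFin.
  by apply: integrable_pushforward.
have iX' : (distribution P X').-integrable setT EFin.
  by apply: integrable_pushforward.
under eq_integral => x _.
  rewrite (_ : integral _ _ _ = (x%:E * \int[P]_w (Y w)%:E)%E); last first.
    under eq_integral => y _ do rewrite EFinM.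
    by rewrite integralZl// (integral_distribution (X := Y')).
  over.
rewrite -(@fineK _ (\int[P]_x (Y x)%:E)%E); last exact: integrable_fin_num.
by rewrite integralZr// (integral_distribution (X := X')).
Qed.

End independence.

(** * Independence of generated sigma-algebras *)

Section pi_systems.
Context d (T : measurableType d) (R : realType) (P : probability T R).

(** For fixed [B], the restriction of [P] to [B] and the multiple of [P] by the number P(B) are two
    finite measures. They agree on the pi-system [G], hence on the sigma-algebra that it
    generates. *)
Lemma indep_systems_sigmal (G : set (set T)) (B : set T) :
  G `<=` measurable -> setI_closed G -> G setT -> measurable B ->
  (forall A, G A -> P (A `&` B) = (P A * P B)%E) ->
  forall A, <<s G >> A -> P (A `&` B) = (P A * P B)%E.
Proof.
move=> Gm GI GT mB GB A sA.
have PB0 : 0 <= fine (P B) by exact: fine_ge0.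
have PBE : P B = (fine (P B))%:E by rewrite fineK ?fin_num_measure.
rewrite PBE muleC.
pose m1 : {measure set T -> \bar R} := mrestr P mB.
pose m2 : {measure set T -> \bar R} := mscale (NngNum PB0) P.
have : m1 A = m2 A; last by [].
apply: (g_sigma_algebra_measure_unique G Gm (fun=> setT)) => //.
- by apply/seteqP; split => // x _; exists 0%N.
- by move=> C GC; rewrite /m1 /m2 /= /mrestr /mscale /= GB// muleC -PBE.
- by move=> _; rewrite /m1 /= /mrestr setTI ltey_eq fin_num_measure.
Qed.

Lemma indep_systems_sigma (G H : set (set T)) :
  G `<=` measurable -> H `<=` measurable ->
  setI_closed G -> setI_closed H -> G setT -> H setT ->
  indep_systems P G H -> indep_systems P <<s G >> <<s H >>.
Proof.
move=> Gm Hm GI HI GT HT GH A B sA sB.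
have mA : measurable A.
  by apply: (smallest_sub (@sigma_algebra_measurable _ T) Gm).
rewrite setIC muleC; apply: (indep_systems_sigmal Hm) => // {}B {sB}HB.
rewrite setIC muleC; apply: (indep_systems_sigmal Gm) => //; first exact: Hm.
by move=> {}A {sA mA} GA; exact: GH.
Qed.

Lemma indep_systemsS (G G' H H' : set (set T)) : G `<=` G' -> H `<=` H' ->
  indep_systems P G' H' -> indep_systems P G H.
Proof. by move=> GG HH GH A B /GG ? /HH ?; exact: GH. Qed.

Context (I : eqType) d' (T' : measurableType d') (U : I -> {RV P >-> T'}).

Definition gen_family (J : set I) : set (set T) :=
  \bigcup_(i in J) g_sigma_algebra_preimage (U i).

(** Events about single variables are not closed under intersection. Their finite intersections form
    a pi-system whose sigma-algebra still contains that of the family; the lists without repetition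
    match the form of [mutually_indep]. *)
Definition cylinders (J : set I) : set (set T) :=
  [set B | exists s : seq I, exists A : I -> set T',
    [/\ uniq s, {in s, forall i, J i}, forall i, measurable (A i) &
        B = \big[setI/setT]_(i <- s) (U i @^-1` A i)]].

Lemma big_setI_in (s : seq I) (A : I -> set T) (w : T) :
  (\big[setI/setT]_(i <- s) A i) w <-> {in s, forall i, A i w}.
Proof.
elim: s => [|i s IH]; first by rewrite big_nil; split => // _ j; rewrite in_nil.
rewrite big_cons; split=> [[Ai /IH As] j|As].
  by rewrite inE => /predU1P[->//|/As].
split; first by apply: As; rewrite mem_head.
by apply/IH => j js; apply: As; rewrite inE js orbT.
Qed.

Lemma cylinders_measurable J : cylinders J `<=` measurable.
Proof.
move=> _ [s [A [_ _ mA ->]]]; apply: bigsetI_measurable => i _.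
by rewrite -[X in measurable X]setTI; exact: measurable_funP.
Qed.

Lemma cylindersI J : setI_closed (cylinders J).
Proof.
move=> _ _ [s [A [us sJ mA ->]]] [t [B [ut tJ mB ->]]].
exists (undup (s ++ t)).
(* Outside its own list each family of events is completed by [setT], so that an index of both lists
   carries the intersection of its two events. *)
exists (fun i => (if i \in s then A i else setT) `&`
                 (if i \in t then B i else setT)).
split; first exact: undup_uniq.
- by move=> i; rewrite mem_undup mem_cat => /orP[/sJ|/tJ].
- by move=> i; apply: measurableI; case: ifP.
- apply/seteqP; split => w.
    move=> [/big_setI_in As /big_setI_in Bt]; apply/big_setI_in => i _ /=.
    by split; case: ifP => //; [move/As|move/Bt].
  move/big_setI_in => AB; split; apply/big_setI_in => i ii.
    by have [|+ _] := AB i; rewrite ?mem_undup ?mem_cat ?ii.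
  by have [|_] := AB i; rewrite ?mem_undup ?mem_cat ?ii ?orbT.
Qed.

Lemma cylindersT J : cylinders J setT.
Proof. by exists [::], (fun=> setT); split => //; rewrite big_nil. Qed.

Lemma gen_family_cylinders J : <<s gen_family J >> `<=` <<s cylinders J >>.
Proof.
apply: smallest_sub => [|_ [i Ji [A mA <-]]]; first exact: smallest_sigma_algebra.
apply: sub_sigma_algebra; exists [:: i], (fun=> A).
by split => //; [move=> j; rewrite inE => /eqP ->|rewrite big_seq1 setTI].
Qed.

Lemma indep_cylinders J K : mutually_indep P U -> J `&` K = set0 ->
  indep_systems P (cylinders J) (cylinders K).
Proof.
move=> iU JK _ _ [s [A [us sJ mA ->]]] [t [B [ut tK mB ->]]].
have st i : i \in s -> i \notin t.
  move=> /sJ Ji; apply/negP => /tK Ki.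
  by have : (J `&` K) i by []; rewrite JK.
(* One assignment of events that equals [A] on [s] and, the lists being disjoint, [B] on [t]: mutual
   independence then applies to [s ++ t] as well as to [s] and to [t]. *)
pose C i := if i \in s then A i else B i.
have AC : \big[setI/setT]_(i <- s) (U i @^-1` A i) =
          \big[setI/setT]_(i <- s) (U i @^-1` C i).
  by apply: eq_big_seq => i si; rewrite /C si.
have BC : \big[setI/setT]_(i <- t) (U i @^-1` B i) =
          \big[setI/setT]_(i <- t) (U i @^-1` C i).
  apply: eq_big_seq => i ti; rewrite /C ifF//.
  by apply/negP => /st; rewrite ti.
have mC i : measurable (C i) by rewrite /C; case: ifP.
rewrite AC BC -big_cat/= iU//; last first.
  rewrite cat_uniq us ut andbT /=; apply/hasPn => i ti.
  by apply/negP => /st; rewrite ti.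
by rewrite big_cat /= -!iU.
Qed.

Lemma indep_gen_family J K : mutually_indep P U -> J `&` K = set0 ->
  indep_systems P <<s gen_family J >> <<s gen_family K >>.
Proof.
move=> iU JK.
apply: indep_systemsS (@gen_family_cylinders J) (@gen_family_cylinders K) _.
apply: indep_systems_sigma; try exact: cylinders_measurable;
  try exact: cylindersI; try exact: cylindersT.
exact: indep_cylinders.
Qed.

Definition adapted (J : set I) d1 (T1 : measurableType d1) (X : T -> T1) :=
  g_sigma_algebra_preimage X `<=` <<s gen_family J >>.

(** Reading adaptedness as measurability for a smaller sigma-algebra on the domain makes the general
    measurability lemmas give stability under composition, pairing and arithmetic. *)
Lemma adaptedP J d1 (T1 : measurableType d1) (X : T -> T1) :
  adapted J X <->
  measurable_fun [set: g_sigma_algebraType (gen_family J)] X.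
Proof.
split=> [aX _ A mA|mX _ [A mA <-]]; last exact: mX.
by apply: aX; exists A.
Qed.

Lemma gen_family_measurable J : <<s gen_family J >> `<=` measurable.
Proof.
apply: (smallest_sub (@sigma_algebra_measurable _ T)) => _ [i _ [A mA <-]].
exact: measurable_funP.
Qed.

Lemma adapted_measurable J d1 (T1 : measurableType d1) (X : T -> T1) :
  adapted J X -> measurable_fun setT X.
Proof.
by move=> aX _ A mA; apply: (@gen_family_measurable J); apply: aX; exists A.
Qed.

Lemma adapted_cst J d1 (T1 : measurableType d1) (c : T1) :
  adapted J (fun=> c).
Proof. by apply/adaptedP; exact: measurable_cst. Qed.

Lemma adapted_U J i : J i -> adapted J (U i).
Proof. by move=> Ji A UA; apply: sub_sigma_algebra; exists i. Qed.

Lemma adaptedS J K d1 (T1 : measurableType d1) (X : T -> T1) :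
  J `<=` K -> adapted J X -> adapted K X.
Proof.
move=> JK aX A /aX; apply: smallest_sub A => [|B [i Ji UB]].
  exact: smallest_sigma_algebra.
by apply: sub_sigma_algebra; exists i => //; exact: JK.
Qed.

Lemma adapted_comp J d1 (T1 : measurableType d1) d2 (T2 : measurableType d2)
  (h : T1 -> T2) (X : T -> T1) : measurable_fun [set: T1] h ->
  adapted J X -> adapted J (h \o X).
Proof. by move=> mh /adaptedP aX; apply/adaptedP; exact: measurableT_comp. Qed.

Lemma adapted_pair J d1 (T1 : measurableType d1) d2 (T2 : measurableType d2)
  (X : T -> T1) (Y : T -> T2) :
  adapted J X -> adapted J Y -> adapted J (fun w => (X w, Y w)).
Proof.
move=> /adaptedP aX /adaptedP aY; apply/adaptedP.
exact: measurable_fun_pair.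
Qed.

Lemma indep_adapted J K d1 (T1 : measurableType d1) d2 (T2 : measurableType d2)
  (X : T -> T1) (Y : T -> T2) : mutually_indep P U -> J `&` K = set0 ->
  adapted J X -> adapted K Y -> indep_RV P X Y.
Proof.
by move=> iU JK aX aY; apply: indep_systemsS aX aY _; exact: indep_gen_family.
Qed.

End pi_systems.

(** * Square-integrable variables *)

Section square_integrable.
Context d (T : measurableType d) (R : realType) (P : probability T R).
Implicit Types X Y : T -> R.

(** Real-valued, so that estimates are accessible to linear arithmetic. Since [fine] sends an
    infinite value to 0, membership in [Lfun] accompanies most uses. *)
Definition mean X : R := fine 'E_P[X].
Definition rms X : R := Num.sqrt (fine 'E_P[X ^+ 2]).
Definition sd X : R := Num.sqrt (fine 'V_P[X]).

Lemma Lfun2P X : X \in Lfun P 2%:E <->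
  measurable_fun setT X /\ P.-integrable setT (EFin \o (X ^+ 2)).
Proof.
split=> [X2|[mX /integrableP[_ iX]]].
  by split; [exact: Lfun_measurable X2|exact: Lfun2_integrable_sqr].
rewrite inE; apply/andP; split; rewrite inE//=.
rewrite /finite_norm unlock /Lnorm poweR_lty//.
move: iX; congr (_ < _)%E; apply: eq_integral => w _ /=.
by rewrite ger0_norm ?sqr_ge0// powR_mulrn// real_normK// num_real.
Qed.

Lemma Lfun21 X : X \in Lfun P 2%:E -> X \in Lfun P 1.
Proof. by apply: Lfun_subset12; rewrite fin_num_measure. Qed.

Lemma Lfun2D X Y : X \in Lfun P 2%:E -> Y \in Lfun P 2%:E ->
  (X + Y)%R \in Lfun P 2%:E.
Proof. by move=> X2 Y2; apply: rpredD => //; rewrite lee1n. Qed.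

Lemma LfunZ (c r : R) X : 1 <= r -> X \in Lfun P r%:E ->
  (fun w => c * X w) \in Lfun P r%:E.
Proof.
move=> r1 Xr; rewrite (_ : (fun _ => _) = c \o* X); first exact: Lfun_scale.
by apply/funext => w /=; rewrite mulrC.
Qed.

Lemma Lfun1Z (c : R) X : X \in Lfun P 1 -> (fun w => c * X w) \in Lfun P 1.
Proof. exact: (@LfunZ c 1). Qed.

Lemma Lfun2Z (c : R) X : X \in Lfun P 2%:E -> (fun w => c * X w) \in Lfun P 2%:E.
Proof. by apply: LfunZ; rewrite ler1n. Qed.

Lemma Lfun2N X : X \in Lfun P 2%:E -> (- X)%R \in Lfun P 2%:E.
Proof.
move=> X2; rewrite (_ : - X = (fun w => -1 * X w)); first exact: Lfun2Z.
by apply/funext => w /=; rewrite mulN1r.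
Qed.

Lemma Lfun2B X Y : X \in Lfun P 2%:E -> Y \in Lfun P 2%:E ->
  (X - Y)%R \in Lfun P 2%:E.
Proof. by move=> X2 Y2; apply: Lfun2D => //; exact: Lfun2N. Qed.

Lemma Lfun2_sum (I : Type) (s : seq I) (X : I -> T -> R) :
  (forall i, X i \in Lfun P 2%:E) -> (\sum_(i <- s) X i)%R \in Lfun P 2%:E.
Proof.
move=> X2; elim/big_ind : _ => //; last exact: Lfun2D.
exact: (Lfun_cst P 0).
Qed.

Lemma meanE X : X \in Lfun P 1 -> 'E_P[X]%E = (mean X)%:E.
Proof. by move=> X1; rewrite /mean fineK// expectation_fin_num. Qed.

Lemma meanD X Y : X \in Lfun P 1 -> Y \in Lfun P 1 ->
  mean (X + Y) = mean X + mean Y.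
Proof. by move=> X1 Y1; rewrite /mean expectationD// fineD// expectation_fin_num. Qed.

Lemma meanB X Y : X \in Lfun P 1 -> Y \in Lfun P 1 ->
  mean (X - Y) = mean X - mean Y.
Proof. by move=> X1 Y1; rewrite /mean expectationB// fineB// expectation_fin_num. Qed.

Lemma meanZ (c : R) X : X \in Lfun P 1 -> mean (fun w => c * X w) = c * mean X.
Proof.
move=> X1; rewrite /mean (_ : (fun _ => _) = c \o* X).
  by rewrite expectationZl// fineM// expectation_fin_num.
by apply/funext => w /=; rewrite mulrC.
Qed.

Lemma mean_cst c : mean (cst c) = c.
Proof. by rewrite /mean expectation_cst. Qed.

Lemma mean_sum (I : Type) (s : seq I) (X : I -> T -> R) :
  (forall i, X i \in Lfun P 2%:E) -> mean (\sum_(i <- s) X i)%R = \sum_(i <- s) mean (X i).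
Proof.
move=> X2; elim: s => [|i s IH]; first by rewrite !big_nil (mean_cst 0).
by rewrite !big_cons meanD ?IH//; apply: Lfun21 => //; exact: Lfun2_sum.
Qed.

Lemma mean_ge0 X : (forall w, 0 <= X w) -> 0 <= mean X.
Proof. by move=> X0; apply: fine_ge0; exact: expectation_ge0. Qed.

Lemma mean_sqr_ge0 X : 0 <= mean (X ^+ 2).
Proof. by apply: mean_ge0 => w; rewrite fctE sqr_ge0. Qed.

Lemma Lfun2M X Y : X \in Lfun P 2%:E -> Y \in Lfun P 2%:E ->
  (X * Y)%R \in Lfun P 1.
Proof. exact: Lfun2_mul_Lfun1. Qed.

Lemma Lfun2_sqr X : X \in Lfun P 2%:E -> (X ^+ 2)%R \in Lfun P 1.
Proof. by move=> X2; rewrite expr2; exact: Lfun2M. Qed.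

Lemma rms_ge0 X : 0 <= rms X. Proof. exact: sqrtr_ge0. Qed.

Lemma sd_ge0 X : 0 <= sd X. Proof. exact: sqrtr_ge0. Qed.

Lemma rms_sqr X : rms X ^+ 2 = mean (X ^+ 2).
Proof. by rewrite sqr_sqrtr//; exact: mean_sqr_ge0. Qed.

Lemma varianceE_sd X : X \in Lfun P 2%:E -> 'V_P[X]%E = (sd X ^+ 2)%:E.
Proof.
move=> X2; rewrite sqr_sqrtr; first by rewrite fineK// variance_fin_num.
by apply: fine_ge0; exact: variance_ge0.
Qed.

Lemma sdE X : sd X = rms (X - cst (mean X))%R.
Proof. by rewrite /sd /rms /variance unlock expr2. Qed.

Lemma mean_sqrD (s t : R) X Y : X \in Lfun P 2%:E -> Y \in Lfun P 2%:E ->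
  mean ((fun w => s * X w + t * Y w) ^+ 2) =
  s ^+ 2 * mean (X ^+ 2) + 2 * (s * t) * mean (X * Y) + t ^+ 2 * mean (Y ^+ 2).
Proof.
move=> X2 Y2.
rewrite [X in mean X](_ : _ = ((fun w => s ^+ 2 * (X ^+ 2) w)
    + (fun w => 2 * (s * t) * (X * Y) w) + (fun w => t ^+ 2 * (Y ^+ 2) w))%R).
  have lX := Lfun2_sqr X2; have lY := Lfun2_sqr Y2; have lXY := Lfun2M X2 Y2.
  rewrite meanD; [|apply: rpredD; exact: Lfun1Z|exact: Lfun1Z].
  rewrite meanD; [|exact: Lfun1Z|exact: Lfun1Z].
  by rewrite !meanZ.
by apply/funext => w; rewrite !fctE /=; ring.
Qed.

(** Cauchy-Schwarz, from the non-negativity of the quadratic form E((sX + tY)^2) in (s, t). *)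
Lemma mean_mul_le X Y : X \in Lfun P 2%:E -> Y \in Lfun P 2%:E ->
  mean (X * Y) <= rms X * rms Y.
Proof.
move=> X2 Y2.
have key s t : 0 <= s ^+ 2 * rms X ^+ 2 + 2 * (s * t) * mean (X * Y)
    + t ^+ 2 * rms Y ^+ 2.
  by rewrite !rms_sqr -mean_sqrD//; exact: mean_sqr_ge0.
have := rms_ge0 X; have := rms_ge0 Y.
move: (rms X) (rms Y) (mean (X * Y)) key => a b c key b0 a0.
rewrite leNgt; apply/negP => abc.
have c0 : 0 < c by apply: le_lt_trans abc; exact: mulr_ge0.
move: b0; rewrite le_eqVlt => /predU1P[b0|b0].
  (* When [rms Y] vanishes the form at s = 1 is affine in t, and this t gives it the value -1. *)
  have := key 1 (- (a ^+ 2 + 1) / (2 * c)); rewrite -b0 expr0n mulr0 addr0.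
  rewrite [X in 0 <= X](_ : _ = -1); last by field; rewrite gt_eqF.
  by rewrite ler0N1.
(* A multiple of the point that minimises the form over t; the value there is negative as soon as c
   > ab. *)
have := key (b ^+ 2) (- c).
rewrite [X in 0 <= X](_ : _ = b ^+ 2 * ((a * b) ^+ 2 - c ^+ 2)); last by ring.
rewrite pmulr_rge0 ?exprn_gt0// subr_ge0 ler_sqr ?nnegrE ?mulr_ge0 ?(ltW c0) ?(ltW b0)//.
by rewrite leNgt abc.
Qed.

Lemma rmsD X Y : X \in Lfun P 2%:E -> Y \in Lfun P 2%:E ->
  rms (X + Y) <= rms X + rms Y.
Proof.
move=> X2 Y2; rewrite -ler_sqr ?nnegrE ?addr_ge0 ?rms_ge0//.
rewrite rms_sqr (_ : X + Y = (fun w => 1 * X w + 1 * Y w)); last first.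
  by apply/funext => w; rewrite !mul1r.
rewrite mean_sqrD// -!rms_sqr sqrrD.
have := mean_mul_le X2 Y2; lra.
Qed.

Lemma rmsZ (c : R) X : X \in Lfun P 2%:E -> rms (fun w => c * X w) = `|c| * rms X.
Proof.
move=> X2; rewrite /rms -/(mean _) -/(mean _).
rewrite (_ : (fun _ => _) ^+ 2 = (fun w => c ^+ 2 * (X ^+ 2) w)).
  by rewrite meanZ ?Lfun2_sqr// sqrtrM ?sqr_ge0// sqrtr_sqr.
by apply/funext => w; rewrite !fctE exprMn.
Qed.

Lemma rms_sum (I : Type) (s : seq I) (X : I -> T -> R) :
  (forall i, X i \in Lfun P 2%:E) ->
  rms (\sum_(i <- s) X i)%R <= \sum_(i <- s) rms (X i).
Proof.
move=> X2; elim: s => [|i s IH].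
  rewrite !big_nil /rms -/(mean _) (_ : 0 ^+ 2 = cst 0 :> (T -> R)).
    by rewrite mean_cst sqrtr0.
  by rewrite expr2 mul0r.
rewrite !big_cons (le_trans (rmsD _ _))//; first exact: Lfun2_sum.
by rewrite lerD2l.
Qed.

Lemma sdD X Y : X \in Lfun P 2%:E -> Y \in Lfun P 2%:E ->
  sd (X + Y) <= sd X + sd Y.
Proof.
move=> X2 Y2; rewrite !sdE meanD; try exact: Lfun21.
rewrite (_ : X + Y - _ = (X - cst (mean X)) + (Y - cst (mean Y))).
  by apply: rmsD; apply: Lfun2B => //; exact: Lfun_cst.
by apply/funext => w; rewrite !fctE; ring.
Qed.

Lemma sdZ (c : R) X : X \in Lfun P 2%:E -> sd (fun w => c * X w) = `|c| * sd X.
Proof.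
move=> X2; rewrite !sdE meanZ; last exact: Lfun21.
rewrite -rmsZ; last by apply: Lfun2B => //; exact: Lfun_cst.
by congr rms; apply/funext => w; rewrite !fctE; ring.
Qed.

Lemma sd_sqr X : X \in Lfun P 2%:E -> sd X ^+ 2 = rms X ^+ 2 - mean X ^+ 2.
Proof.
move=> X2; apply: EFin_inj; rewrite -varianceE_sd// varianceE//.
rewrite rms_sqr EFinB -!meanE ?Lfun2_sqr//; first by rewrite EFin_expe -meanE// Lfun21.
Qed.

Lemma sd_le_rms X : X \in Lfun P 2%:E -> sd X <= rms X.
Proof.
move=> X2; rewrite -ler_sqr ?nnegrE ?rms_ge0 ?sd_ge0// sd_sqr//.
by rewrite gerBl sqr_ge0.
Qed.

Lemma mean_le_rms X : X \in Lfun P 2%:E -> `|mean X| <= rms X.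
Proof.
move=> X2; rewrite -ler_sqr ?nnegrE ?rms_ge0// real_normK ?num_real//.
by rewrite -subr_ge0 -sd_sqr// sqr_ge0.
Qed.

Lemma sd_subl_cst X c : X \in Lfun P 2%:E -> sd (X - cst c)%R = sd X.
Proof. by move=> X2; rewrite /sd varianceB_cst_r. Qed.

Lemma sd_sqrD X Y : X \in Lfun P 2%:E -> Y \in Lfun P 2%:E ->
  mean (X * Y) = mean X * mean Y -> sd (X + Y) ^+ 2 = sd X ^+ 2 + sd Y ^+ 2.
Proof.
move=> X2 Y2 XY; rewrite !sd_sqr ?Lfun2D//.
rewrite meanD; try exact: Lfun21.
rewrite rms_sqr (_ : X + Y = (fun w => 1 * X w + 1 * Y w)); last first.
  by apply/funext => w; rewrite !mul1r.
by rewrite mean_sqrD// XY !rms_sqr; ring.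
Qed.

Lemma mean_sum_mul (I J : Type) (s : seq I) (t : seq J) (X : I -> T -> R)
    (Y : J -> T -> R) :
  (forall i, X i \in Lfun P 2%:E) -> (forall i, Y i \in Lfun P 2%:E) ->
  (forall i j, mean (X i * Y j) = mean (X i) * mean (Y j)) ->
  mean ((\sum_(i <- s) X i) * (\sum_(j <- t) Y j))%R =
  mean (\sum_(i <- s) X i) * mean (\sum_(j <- t) Y j).
Proof.
move=> X2 Y2 XY.
have half i : mean (X i * \sum_(j <- t) Y j) = mean (X i) * mean (\sum_(j <- t) Y j).
  elim: t => [|j t IH]; first by rewrite !big_nil mulr0 (mean_cst 0) mulr0.
  have Yt := Lfun2_sum t Y2.
  rewrite !big_cons mulrDr !meanD ?Lfun2M//; try exact: Lfun21.
  by rewrite IH XY mulrDr.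
elim: s => [|i s IH]; first by rewrite !big_nil mul0r (mean_cst 0) mul0r.
have Yt := Lfun2_sum t Y2; have Xs := Lfun2_sum s X2.
rewrite !big_cons mulrDl !meanD ?Lfun2M//; try exact: Lfun21.
by rewrite IH half mulrDl.
Qed.

Lemma mean_indepM X Y : X \in Lfun P 2%:E -> Y \in Lfun P 2%:E ->
  indep_RV P X Y -> mean (X * Y) = mean X * mean Y.
Proof.
move=> /Lfun21 X1 /Lfun21 Y1 /(expectation_indepM X1 Y1)[_ +].
by rewrite /mean => ->; rewrite fineM// expectation_fin_num.
Qed.

End square_integrable.

(** * Laws of the shifted chains *)

Section chain_laws.
Context (R : realType) (dO dF dF' : measure_display)
    (Omega : measurableType dO) (F : measurableType dF)
    (F' : measurableType dF')
    (P : probability Omega R)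
    (g : F * F' -> F) (mg : measurable_fun [set: F * F'] g)
    (U : int -> {RV P >-> F'}) (iidU : iid P U) (x0 : F).

Local Notation cs := (chain_steps g U x0).

Lemma adapted_chain_steps m n :
  adapted U [set i : int | (- m <= i)%R && (i < n%:Z - m)%R] (cs m n).
Proof.
elim: n => [|n IH]; first exact: adapted_cst.
apply: (adapted_comp (h := g) (X := fun w => (cs m n w, U (n%:Z - m) w))) => //.
apply: adapted_pair; last by apply: adapted_U => /=; lia.
by apply: adaptedS IH => i /=; lia.
Qed.

Arguments adapted_chain_steps : clear implicits.

Lemma measurable_chain_steps m n : measurable_fun setT (cs m n).
Proof. exact: (adapted_measurable (adapted_chain_steps m n)). Qed.

Lemma same_law_comp d1 (T1 : measurableType d1) d2 (T2 : measurableType d2)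
    (h : T1 -> T2) (X Y : Omega -> T1) : measurable_fun [set: T1] h ->
  same_law P X Y -> same_law P (h \o X) (h \o Y).
Proof.
move=> mh XY A mA; apply: (XY (h @^-1` A)).
by rewrite -[X in measurable X]setTI; exact: mh.
Qed.

(** The innovation lies outside the indices on which the state depends, so the pair has a product
    law. An arbitrary state space and transition [h] serve both a single chain and two chains moved
    by the same innovation. *)
Lemma same_law_adapted_step d1 (E : measurableType d1) d2 (E' : measurableType d2)
    (h : E * F' -> E') (J J' : set int) (i i' : int) (V V' : Omega -> E) :
  measurable_fun [set: E * F'] h -> adapted U J V -> adapted U J' V' ->
  ~ J i -> ~ J' i' -> same_law P V V' ->
  same_law P (fun w => h (V w, U i w)) (fun w => h (V' w, U i' w)).
Proof.
move=> mh aV aV' Ji Ji' VV'.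
pose X : {RV P >-> E} :=
  HB.pack V (isMeasurableFun.Build _ _ _ _ _ (adapted_measurable aV)).
pose X' : {RV P >-> E} :=
  HB.pack V' (isMeasurableFun.Build _ _ _ _ _ (adapted_measurable aV')).
have indep (K : set int) j (W : Omega -> E) :
    adapted U K W -> ~ K j -> indep_RV P W (U j).
  move=> aW Kj; apply: (indep_adapted (K := [set j]) iidU.1 _ aW).
    by apply/seteqP; split => // l [/= Kl lj]; apply: Kj; rewrite -lj.
  exact: adapted_U.
apply: (same_law_comp (h := h) (X := fun w => (V w, U i w))
  (Y := fun w => (V' w, U i' w)) mh).
apply: (same_law_pair (X := X) (X' := X')) => //.
- exact: indep aV Ji.
- exact: indep aV' Ji'.
- exact: iidU.2.
Qed.

Lemma same_law_chain_steps m m' n : same_law P (cs m n) (cs m' n).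
Proof.
elim: n => [|n IH]; first by [].
apply: (same_law_adapted_step (h := g) mg (adapted_chain_steps m n)
  (adapted_chain_steps m' n)) => //=; lia.
Qed.

(** Both components stand at time n - m and read the same next innovation, so the pair is itself a
    chain, with the doubled transition [h]. *)
Lemma same_law_chain_pair m m' (d n : nat) :
  same_law P (fun w => (cs (m + d%:Z) (d + n) w, cs m n w))
             (fun w => (cs (m' + d%:Z) (d + n) w, cs m' n w)).
Proof.
elim: n => [|n IH].
  (* The chain that starts later is still at [x0], so only the law of the other one matters. *)
  apply: (same_law_comp (h := fun x => (x, x0))
    (X := cs (m + d%:Z) (d + 0)) (Y := cs (m' + d%:Z) (d + 0))).
    exact: measurable_fun_pair.
  exact: same_law_chain_steps.
pose h (z : (F * F) * F') := (g (z.1.1, z.2), g (z.1.2, z.2)).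
have mh : measurable_fun [set: (F * F) * F'] h.
  apply: measurable_fun_pair; apply: (measurableT_comp mg);
    apply: measurable_fun_pair => //; exact: measurableT_comp.
have aV (a : int) : adapted U [set i : int | (- (a + d%:Z) <= i)%R && (i < n%:Z - a)%R]
    (fun w => (cs (a + d%:Z) (d + n) w, cs a n w)).
  apply: adapted_pair.
    by apply: adaptedS (adapted_chain_steps _ _) => i /=; lia.
  by apply: adaptedS (adapted_chain_steps _ _) => i /=; lia.
have := same_law_adapted_step (i := n%:Z - m) (i' := n%:Z - m') mh (aV m) (aV m') _ _ IH.
rewrite addnS /= (_ : (d + n)%N%:Z - (m + d%:Z) = n%:Z - m); last by lia.
rewrite (_ : (d + n)%N%:Z - (m' + d%:Z) = n%:Z - m'); last by lia.
apply; lia.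
Qed.

Variables (f : F -> R) (mf : measurable_fun [set: F] f)
  (f2 : forall i : nat, f \o chain g U x0 i%:Z 0 \in Lfun P 2%:E)
  (nu : nat -> R)
  (nu_bound : forall i m : nat,
       ('E_P[fun w => ((f (chain g U x0 i%:Z m%:Z w)
                        - f (chain g U x0 i%:Z 0 w)) ^+ 2)%R] <= (nu i)%:E)%E).

Definition fchain (m : int) (n : nat) : Omega -> R := f \o cs m n.

Lemma measurable_fchain m n : measurable_fun setT (fchain m n).
Proof. exact: measurableT_comp (measurable_chain_steps _ _). Qed.

Lemma adapted_fchain m n :
  adapted U [set i : int | (- m <= i)%R && (i < n%:Z - m)%R] (fchain m n).
Proof. exact: adapted_comp (adapted_chain_steps m n). Qed.

Arguments adapted_fchain : clear implicits.

Lemma fchain_same_law m m' n : same_law P (fchain m n) (fchain m' n).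
Proof. exact: same_law_comp (same_law_chain_steps _ _ _). Qed.

Lemma fchain0 n : fchain 0 n = f \o chain g U x0 n%:Z 0.
Proof. by rewrite /fchain /chain addr0. Qed.

Lemma same_law_Lfun2 (X Y : Omega -> R) : measurable_fun setT Y ->
  same_law P X Y -> X \in Lfun P 2%:E ->
  Y \in Lfun P 2%:E /\ mean P X = mean P Y.
Proof.
move=> mY XY X2; have mX := Lfun_measurable X2.
pose X' : {RV P >-> R} := HB.pack X (isMeasurableFun.Build _ _ _ _ _ mX).
pose Y' : {RV P >-> R} := HB.pack Y (isMeasurableFun.Build _ _ _ _ _ mY).
split.
  apply/Lfun2P; split => //; move/Lfun2P : X2 => [_].
  apply: (same_law_integrable (X := X') (Y := Y')
    (h := fun x => (x ^+ 2)%:E)) => //.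
  by apply/measurable_EFinP; exact: measurable_funX.
rewrite /mean unlock; congr fine.
apply: (same_law_integral (X := X') (Y := Y') (h := EFin)) => //.
exact/Lfun1_integrable/Lfun21.
Qed.

Lemma fchain_Lfun2 m n : fchain m n \in Lfun P 2%:E.
Proof.
have [] // := same_law_Lfun2 (measurable_fchain m n) (fchain_same_law 0 m n).
by rewrite fchain0.
Qed.

Lemma mean_fchain m n : mean P (fchain m n) = mean P (fchain 0 n).
Proof.
by have [] // := same_law_Lfun2 (measurable_fchain 0 n) (fchain_same_law m 0 n)
  (fchain_Lfun2 m n).
Qed.

(** Shifted to starting times -d and 0, the pair is the one in [nu_bound], namely X_{n,d} and
    X_n. *)
Lemma rms_fchainB m (d n : nat) :
  rms P (fchain (m + d%:Z) (d + n) - fchain m n)%R <= Num.sqrt (nu n).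
Proof.
rewrite /rms ler_wsqrtr// -lee_fin fineK; last first.
  by rewrite expectation_fin_num// Lfun2_sqr// Lfun2B//; exact: fchain_Lfun2.
apply: le_trans (nu_bound n d); rewrite unlock le_eqVlt; apply/orP; left; apply/eqP.
have mV a : measurable_fun setT (fun w => (cs (a + d%:Z) (d + n) w, cs a n w)).
  by apply: measurable_fun_pair; exact: measurable_chain_steps.
pose X a : {RV P >-> (F * F)%type} :=
  HB.pack (fun w => (cs (a + d%:Z) (d + n) w, cs a n w))
    (isMeasurableFun.Build _ _ _ _ _ (mV a)).
have mh : measurable_fun [set: F * F] (fun z => ((f z.1 - f z.2) ^+ 2)%:E).
  apply/measurable_EFinP; apply: measurable_funX; apply: measurable_funB;
    exact: measurableT_comp.
have XX : same_law P (X m) (X 0) by exact: same_law_chain_pair.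
have := ge0_same_law_integral XX mh.
rewrite /= /fchain /chain add0r addr0 (addnC d n) => <- //.
by move=> z; rewrite lee_fin sqr_ge0.
Qed.

(** The first factor depends on the innovations before time n - m, the second on those from time -m'
    on. *)
Lemma mean_fchainM m n m' n' : (n%:Z - m <= - m')%R ->
  mean P (fchain m n * fchain m' n')%R = mean P (fchain m n) * mean P (fchain m' n').
Proof.
move=> le; apply: mean_indepM; try exact: fchain_Lfun2.
apply: (indep_adapted iidU.1 _ (adapted_fchain m n) (adapted_fchain m' n')).
by apply/seteqP; split => // i [/=]; lia.
Qed.

End chain_laws.

(** * Tail sums *)

Section nubar.
Context (R : realType) (nu : nat -> R).
Hypotheses (nu_pos : forall i, 0 < nu i)
  (nu_decr : forall i j : nat, (i <= j)%N -> nu j <= nu i)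
  (nu_sum : cvgn (series (nu_term nu))).
Local Notation t := (nu_term nu).
Local Notation nubar := (nubar nu).

Lemma nu_term_gt0 i : 0 < t i.
Proof. by rewrite sqrtr_gt0 divr_gt0// ltr0n. Qed.

Lemma nubarE j : nubar j = limn (series t) - series t j.
Proof.
apply/cvg_lim => //.
apply: (@cvg_trans _ ((fun n => series t n - series t j) @ \oo)).
  apply: near_eq_cvg; near=> n.
  by rewrite sub_series_geq//; near: n; exact: nbhs_infty_ge.
by apply: cvgB => //; exact: cvg_cst.
Unshelve. all: by end_near. Qed.

Lemma nubar_sum i j : (i <= j)%N -> nubar i = \sum_(i <= l < j) t l + nubar j.
Proof.
by move=> ij; rewrite !nubarE -(sub_series_geq _ ij); ring.
Qed.

Lemma nd_series_nu_term : nondecreasing_seq (series t).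
Proof.
apply/nondecreasing_seqP => n.
by rewrite seriesEnat /= big_nat_recr//= lerDl ltW// nu_term_gt0.
Qed.

Lemma nubar_gt0 j : 0 < nubar j.
Proof.
rewrite (nubar_sum (leqnSn j)) big_nat1 ltr_pwDl ?nu_term_gt0//.
by rewrite nubarE subr_ge0 nondecreasing_cvgn_le//; exact: nd_series_nu_term.
Qed.

Lemma nubar_le i j : (i <= j)%N -> nubar j <= nubar i.
Proof.
move=> ij; rewrite (nubar_sum ij) lerDr sumr_ge0// => l _.
by rewrite ltW// nu_term_gt0.
Qed.

Lemma series_le_nubar n : series t n <= nubar 0.
Proof.
by rewrite (nubar_sum (leq0n n)) seriesEnat/= lerDl ltW// nubar_gt0.
Qed.

(** Every index l of the range satisfies nu(l) >= nu(j) and l + 1 <= j; the latter is why the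
    divisor is j and not j + 1. *)
Lemma nubar_diff_ge i j : (i <= j)%N ->
  (j - i)%:R * Num.sqrt (nu j / j%:R) <= nubar i - nubar j.
Proof.
move=> ij; rewrite (nubar_sum ij) addrK.
rewrite mulr_natl -sumr_const_nat; apply: ler_sum_nat => l /andP[_ lj].
rewrite ler_wsqrtr//; apply: ler_pM; rewrite ?invr_ge0 ?ler0n ?(ltW (nu_pos _))//.
  by apply: nu_decr; exact: ltnW.
by rewrite lef_pV2 ?posrE ?ltr0n ?ler_nat//; exact: leq_trans lj.
Qed.

Lemma nu_le_nubar0 n : n%:R * nu n <= nubar 0 ^+ 2.
Proof.
have [->|n0] := posnP n; first by rewrite mul0r sqr_ge0.
have := nubar_diff_ge (leq0n n); rewrite subn0 => le.
have n0' : 0 < n%:R :> R by rewrite ltr0n.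
have : n%:R * Num.sqrt (nu n / n%:R) <= nubar 0.
  by apply: le_trans le _; rewrite gerBl ltW// nubar_gt0.
rewrite -ler_sqr ?nnegrE ?mulr_ge0 ?sqrtr_ge0 ?(ltW (nubar_gt0 _)) ?(ltW n0')//.
rewrite exprMn sqr_sqrtr ?divr_ge0 ?(ltW n0') ?(ltW (nu_pos _))//.
by rewrite (_ : n%:R ^+ 2 * (nu n / n%:R) = n%:R * nu n)//; field; rewrite gt_eqF.
Qed.

(** Monotonicity and summability together force nu(n) = O(1/n), by [nu_le_nubar0]. *)
Lemma cvg_sqrt_nu : Num.sqrt (nu n) @[n --> \oo] --> (0 : R).
Proof.
rewrite -cvg_shiftS.
apply: (@squeeze_cvgr _ _ _ _ (fun=> 0) (fun n => nubar 0 * Num.sqrt (harmonic n))).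
- near=> n; rewrite sqrtr_ge0/=.
  rewrite -[nubar 0]ger0_norm ?(ltW (nubar_gt0 _))// -sqrtr_sqr -sqrtrM ?sqr_ge0//.
  by rewrite ler_wsqrtr// ler_pdivlMr ?ltr0n// mulrC nu_le_nubar0.
- exact: cvg_cst.
- rewrite -[X in _ --> X](mulr0 (nubar 0)); apply: cvgM; first exact: cvg_cst.
  rewrite -[X in _ --> X](sqrtr0 R).
  apply: (@cvg_comp _ _ _ (@harmonic R) (@Num.sqrt R) \oo (nbhs (0 : R))).
    exact: cvg_harmonic.
  exact: sqrt_continuous.
Unshelve. all: by end_near. Qed.

Local Notation H r := (series t (2 ^ r)%N).
Local Notation A r := (series (fun i => Num.sqrt (nu i)) (2 ^ r)%N).
Local Notation w r := (Num.sqrt (2 ^+ r : R)).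

Lemma sqrt_nuE i : Num.sqrt (nu i) = t i * Num.sqrt i.+1%:R.
Proof.
by rewrite -sqrtrM ?divr_ge0 ?(ltW (nu_pos _))// divfK.
Qed.

(** Two corresponding summands differ by the factor sqrt(i + 1), at most sqrt(2^(r+1)) on this
    range. The coupling errors of a dyadic range are thus paid for by an increment of the convergent
    series. *)
Lemma sqrt_nu_sum_le r : A r.+1 - A r <= w r.+1 * (H r.+1 - H r).
Proof.
have le : (2 ^ r <= 2 ^ r.+1)%N by rewrite leq_exp2l.
rewrite !(sub_series_geq _ le) big_distrr/=; apply: ler_sum_nat => i /andP[_ i2].
rewrite sqrt_nuE mulrC ler_wpM2r ?(ltW (nu_term_gt0 _))//.
by rewrite ler_wsqrtr// -natrX ler_nat.
Qed.

(* The subtracted term pays for the error [A r] made at each doubling of the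
   block length: 5 / 2 * (sqrt 2 - 1) >= 1. *)
Definition dyadic_bound r : R := w r * (t 0%N + 5 / 2 * H r) - 5 / 2 * A r.

Lemma dyadic_bound0 : dyadic_bound 0 = Num.sqrt (nu 0%N).
Proof.
rewrite /dyadic_bound expr0 sqrtr1 !seriesEnat /= expn0 !big_nat1 sqrt_nuE sqrtr1.
by lra.
Qed.

Lemma dyadic_boundS r :
  Num.sqrt 2 * dyadic_bound r + A r <= dyadic_bound r.+1.
Proof.
rewrite /dyadic_bound exprSr sqrtrM ?exprn_ge0// -[in leRHS]sqrtrM ?exprn_ge0//.
rewrite -exprSr.
have := sqrt_nu_sum_le r.
have -> : w r.+1 = w r * Num.sqrt 2 by rewrite exprSr sqrtrM ?exprn_ge0.
have A0 : 0 <= A r by rewrite seriesEnat /= sumr_ge0// => i _; exact: sqrtr_ge0.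
have : 7 / 5 <= Num.sqrt 2 :> R.
  rewrite -ler_sqr ?nnegrE ?sqrtr_ge0 ?divr_ge0// sqr_sqrtr//.
  by lra.
move: A0; set a := A r; set a' := A r.+1; set s := Num.sqrt 2; set v := w r.
set h := H r; set h' := H r.+1 => a0 s7 le.
have : 7 / 5 * a <= s * a by rewrite ler_wpM2r.
lra.
Qed.

Lemma dyadic_bound_le r : dyadic_bound r <= w r * (7 / 2 * nubar 0).
Proof.
rewrite /dyadic_bound.
have A0 : 0 <= A r by rewrite seriesEnat /= sumr_ge0// => i _; exact: sqrtr_ge0.
apply: (@le_trans _ _ (w r * (t 0%N + 5 / 2 * H r))).
  by rewrite gerBl mulr_ge0.
rewrite ler_wpM2l ?sqrtr_ge0//.
have := series_le_nubar (2 ^ r).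
have := series_le_nubar 1; rewrite seriesEnat /= big_nat1.
lra.
Qed.

Lemma sqrt_nu_series n r : (n <= 2 ^ r)%N ->
  \sum_(0 <= i < n) Num.sqrt (nu i) <= A r.
Proof.
by move=> nr; rewrite seriesEnat/= (big_cat_nat (leq0n n) nr)//= lerDl sumr_ge0.
Qed.

End nubar.

(** * Variance of blocks of length at most a power of two *)

Section block_variance.
Context (R : realType) (nu : nat -> R).
Hypotheses (nu_pos : forall i, 0 < nu i)
  (nu_decr : forall i j : nat, (i <= j)%N -> nu j <= nu i)
  (nu_sum : cvgn (series (nu_term nu))).
Context d (T : measurableType d) (P : probability T R).
(** Models [fchain]: [Y m n] is the value after n steps of the chain started at time -m, hence at
    time n - m. In [YB] both variables live at the same time; [YM] concerns a chain that starts when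
    the other one has stopped. *)
Variable Y : int -> nat -> T -> R.
Hypotheses (Y2 : forall m n, Y m n \in Lfun P 2%:E)
  (Y0 : forall m, exists c, Y m 0%N = cst c)
  (YB : forall m (l n : nat),
    rms P (Y (m + l%:Z) (l + n) - Y m n)%R <= Num.sqrt (nu n))
  (YM : forall m n m' n', (n%:Z - m <= - m')%R ->
    mean P (Y m n * Y m' n')%R = mean P (Y m n) * mean P (Y m' n')).

(** The induction ranges over all [m] and [a] because its hypothesis is used twice: for the first
    half at the same start, and for the second half after a restart, with offset 0. *)
Lemma sd_block_dyadic r m a n : (n <= 2 ^ r)%N ->
  sd P (\sum_(0 <= i < n) Y m (i + a)%N)%R <= dyadic_bound nu r.
Proof.
elim: r m a n => [|r IH] m a n nr.
  rewrite dyadic_bound0//; move: n nr => [|[|//]] _.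
    rewrite big_nil sdE (mean_cst P 0) subrr.
    by rewrite /rms expr2 mul0r (expectation_cst P 0) sqrtr0 sqrtr_ge0.
  (* The chain restarted at the very time of the single term is constant, and the term is within
     sqrt(nu(0)) of it. *)
  rewrite big_nat1 add0n; have [c Yc] := Y0 (m - a%:Z).
  have := YB (m - a%:Z) a 0; rewrite subrK addn0 Yc; apply: le_trans.
  rewrite -(sd_subl_cst c)//; apply: sd_le_rms.
  by apply: Lfun2B => //; exact: Lfun_cst.
have [n1 [n2 [nE n1r n2r]]] :
    exists n1 n2, [/\ n = (n1 + n2)%N, (n1 <= 2 ^ r)%N & (n2 <= 2 ^ r)%N].
  exists (minn n (2 ^ r)), (n - 2 ^ r)%N; split; last 1 first.
  - by rewrite leq_subLR addnn -mul2n -expnS.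
  - by lia.
  - exact: geq_minr.
rewrite nE (big_cat_nat (leq0n n1)) ?leq_addr//=.
rewrite -{2}[n1]add0n big_addn addKn.
set S1 := \sum_(_ <= _ < n1) _; set S2 := \sum_(_ <= _ < n2) _.
(* [S'] is the second half for the chain restarted at its first index: it is
   independent of the first half [S1]. *)
pose S' := (\sum_(0 <= i < n2) Y (m - (n1 + a)%:Z) (i + 0)%N)%R.
pose E := (\sum_(0 <= i < n2) (Y m (i + n1 + a)%N - Y (m - (n1 + a)%:Z) i))%R.
have S2E : S2 = (S' + E)%R.
  by rewrite /S' /E -big_split/=; apply: eq_bigr => i _; rewrite addn0 subrKC.
have L1 : S1 \in Lfun P 2%:E by exact: Lfun2_sum.
have L' : S' \in Lfun P 2%:E by exact: Lfun2_sum.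
have LE : E \in Lfun P 2%:E by apply: Lfun2_sum => i; exact: Lfun2B.
rewrite S2E addrA; apply: le_trans (dyadic_boundS nu_pos r).
apply: (le_trans (sdD _ LE)); first exact: Lfun2D.
(* The coupling error [E] costs at most the sum of the sqrt(nu(i)); the uncorrelated halves [S1] and
   [S'] account for the factor sqrt 2. *)
apply: lerD; last first.
  apply: (le_trans (sd_le_rms LE)).
  apply: (le_trans (rms_sum _ _)); first by move=> i; exact: Lfun2B.
  apply: le_trans (sqrt_nu_series _ n2r); apply: ler_sum => i _.
  have := YB (m - (n1 + a)%:Z) (n1 + a) i.
  by rewrite subrK [in (n1 + a + i)%N]addnC addnA.
have b0 : 0 <= dyadic_bound nu r by apply: le_trans (IH m a n1 n1r); exact: sd_ge0.
rewrite -ler_sqr ?nnegrE ?sd_ge0 ?mulr_ge0 ?sqrtr_ge0// exprMn.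
rewrite [X in X * _]sqr_sqrtr// sd_sqrD//; last first.
  rewrite /S1 /S' !big_mkord; apply: mean_sum_mul => // i j; apply: YM.
  by have := ltn_ord i; lia.
have := IH m a n1 n1r; have := IH (m - (n1 + a)%:Z) 0 n2 n2r.
rewrite -/S1 -/S' -!(ler_sqr (x := sd _ _)) ?nnegrE ?sd_ge0//; lra.
Qed.

End block_variance.

(** * The parameters of the estimator *)

Section estimator_parameters.
Context (R : realType) (nu : nat -> R).
Hypotheses (nu_pos : forall i, 0 < nu i)
  (nu_decr : forall i j : nat, (i <= j)%N -> nu j <= nu i)
  (nu_sum : cvgn (series (nu_term nu))).
Local Notation nubar := (nubar nu).
Variables (k : nat) (k_gt0 : (0 < k)%N).
Local Notation D l := (nubar (k * 2 ^ l) - nubar (k * 2 ^ l.+1)).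

(** Converts a drop of the tail sums into a bound on nu(j); the applications have i <= j / 2 and c =
    1/2. *)
Lemma sqr_nubar_diff_ge (i j : nat) (c : R) : (i <= j)%N -> (0 < j)%N ->
  0 <= c -> c * j%:R <= (j - i)%:R -> c ^+ 2 * (j%:R * nu j) <= (nubar i - nubar j) ^+ 2.
Proof.
move=> ij j0 c0 cj; have j0' : 0 < j%:R :> R by rewrite ltr0n.
have njj : 0 <= nu j / j%:R by rewrite divr_ge0 ?ltW.
have le : c * j%:R * Num.sqrt (nu j / j%:R) <= nubar i - nubar j.
  by apply: le_trans (nubar_diff_ge nu_pos nu_decr nu_sum ij); rewrite ler_wpM2r ?sqrtr_ge0.
have lhs0 : 0 <= c * j%:R * Num.sqrt (nu j / j%:R).
  by rewrite !mulr_ge0 ?sqrtr_ge0 ?(ltW j0').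
move: (le); rewrite -ler_sqr ?nnegrE ?(le_trans lhs0)//.
rewrite exprMn sqr_sqrtr//; congr (_ <= _); field.
by rewrite gt_eqF.
Qed.

Lemma p_tailE l : p_tail nu k l.+2 = D l / (2 ^+ l.+2 * nubar k).
Proof. by rewrite /p_tail subn2 subn1. Qed.

Lemma nubar_dyadic_gt0 l : 0 < D l.
Proof.
have k2 : (0 < k * 2 ^ l.+1)%N by rewrite muln_gt0 k_gt0 expn_gt0.
have kl : (k * 2 ^ l <= k * 2 ^ l.+1)%N by rewrite leq_mul2l leq_exp2l// leqnSn orbT.
apply: lt_le_trans (nubar_diff_ge nu_pos nu_decr nu_sum kl).
rewrite mulr_gt0 ?sqrtr_gt0 ?divr_gt0 ?ltr0n//.
by rewrite subn_gt0 ltn_mul2l k_gt0 ltn_exp2l// ltnSn.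
Qed.

Lemma nubar_dyadic_sum n : \sum_(0 <= l < n) D l <= nubar k.
Proof.
rewrite (eq_bigr (fun l => - nubar (k * 2 ^ l.+1)%N - - nubar (k * 2 ^ l)%N)).
  rewrite (telescope_sumr (fun l => - nubar (k * 2 ^ l)%N))// expn0 muln1 opprK.
  by rewrite addrC gerBl ltW// nubar_gt0.
by move=> l _; rewrite opprK addrC.
Qed.

Lemma p_tail_gt0 l : 0 < p_tail nu k l.+2.
Proof.
by rewrite p_tailE divr_gt0 ?nubar_dyadic_gt0// mulr_gt0 ?exprn_gt0 ?nubar_gt0.
Qed.

Lemma sum_from2E (V : zmodType) (F : nat -> V) n :
  \sum_(2 <= l < n.+2) F l = \sum_(0 <= l < n) F l.+2.
Proof. by rewrite -[2%N in LHS]add0n big_addn subn2 /=; apply: eq_bigr => i _; rewrite addn2. Qed.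

(** Here 2^l is at least 4 and the differences telescope to at most [nubar k]. This leaves a mass of
    at least 3/4 for the first two levels, whence the bounds on p_1. *)
Lemma p_tail_sum n : 0 <= \sum_(2 <= l < n) p_tail nu k l <= 4^-1.
Proof.
case: n => [|[|n]]; try by rewrite big_geq// lexx invr_ge0 ler0n.
rewrite sum_from2E; apply/andP; split.
  by apply: sumr_ge0 => l _; rewrite ltW// p_tail_gt0.
have B0 := nubar_gt0 nu_pos nu_sum k.
apply: (@le_trans _ _ (\sum_(0 <= l < n) (4 * nubar k)^-1 * D l)).
  apply: ler_sum => l _; rewrite p_tailE mulrC ler_wpM2r ?(ltW (nubar_dyadic_gt0 _))//.
  have p2 : 4 <= 2 ^+ l.+2 :> R by rewrite -natrX ler_nat !expnS; have := expn_gt0 2 l; lia.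
  have p0 : 0 < 2 ^+ l.+2 :> R by rewrite exprn_gt0.
  by rewrite lef_pV2 ?posrE ?(mulr_gt0 _ B0)// ler_wpM2r ?(ltW B0).
rewrite -big_distrr/= invfM -mulrA; have := nubar_dyadic_sum n.
rewrite -(ler_pM2l (x := (nubar k)^-1)) ?invr_gt0// mulVf ?gt_eqF//; lra.
Qed.

Lemma p_one_bounds : 4^-1 <= p_one nu k <= 3^-1.
Proof.
have cv : cvgn (fun n => \sum_(2 <= l < n) p_tail nu k l).
  apply: nondecreasing_is_cvgn.
    apply/nondecreasing_seqP => -[|[|n]]; try by rewrite !big_geq.
    by rewrite !sum_from2E big_nat_recr//= lerDl ltW// p_tail_gt0.
  by exists 4^-1 => _ [n _ <-]; have /andP[] := p_tail_sum n.
have lo : 0 <= \big[+%R/0]_(2 <= l <oo) p_tail nu k l.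
  by apply: limr_ge => //; near=> n; have /andP[] := p_tail_sum n.
have hi : \big[+%R/0]_(2 <= l <oo) p_tail nu k l <= 4^-1.
  by apply: limr_le => //; near=> n; have /andP[] := p_tail_sum n.
by rewrite /p_one; apply/andP; split; lra.
Unshelve. all: by end_near. Qed.

Lemma p_dist_gt0 l : 0 < p_dist nu k l.
Proof.
have /andP[lo _] := p_one_bounds; have p1 : 0 < p_one nu k.
  by apply: lt_le_trans lo; rewrite invr_gt0.
by case: l => [|[|l]]; [rewrite mulr_gt0| |exact: p_tail_gt0].
Qed.

(** The powers of 2 cancel in the tail, which telescopes to at most 1; the levels 0 and 1 contribute
    2 p_1 each, with p_1 <= 1/3. *)
Lemma p_dist_sum_exp2 n : \sum_(0 <= l < n) p_dist nu k l * 2 ^+ l <= 7 / 3.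
Proof.
apply: (@le_trans _ _ (\sum_(0 <= l < n.+2) p_dist nu k l * 2 ^+ l)).
  rewrite (big_cat_nat (leq0n n) (ltnW (leqnSn n.+1)))//= lerDl sumr_ge0// => l _.
  by rewrite mulr_ge0 ?exprn_ge0// ltW// p_dist_gt0.
rewrite 2?big_nat_recl//=.
have -> : \sum_(0 <= l < n) p_tail nu k l.+2 * 2 ^+ l.+2 =
    (nubar k)^-1 * \sum_(0 <= l < n) D l.
  rewrite big_distrr/=; apply: eq_bigr => l _; rewrite p_tailE; field.
  by rewrite gt_eqF ?nubar_gt0 // gt_eqF// exprn_gt0.
have := nubar_dyadic_sum n; have B0 := nubar_gt0 nu_pos nu_sum k.
rewrite -(ler_pM2l (x := (nubar k)^-1)) ?invr_gt0// mulVf ?gt_eqF//.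
have /andP[_ +] := p_one_bounds; rewrite expr0 expr1; lra.
Qed.

Lemma Z_time_le (tau : nat -> nat -> R)
    (htau : forall l, 0 <= tau k l <= level_cost R k l.+1 + level_cost R k l) :
  (0 <= Z_time (p_dist nu k) tau k <= (7 * k%:R)%:E)%E.
Proof.
have pt0 l : 0 <= p_dist nu k l * tau k l.
  by have /andP[? _] := htau l; rewrite mulr_ge0// ltW// p_dist_gt0.
apply/andP; split; first by apply: nneseries_ge0 => l _ _; rewrite lee_fin.
apply: lime_le; first by apply: is_cvg_nneseries => l _ _; rewrite lee_fin.
near=> n; rewrite sumEFin lee_fin.
(* The cost of level l is at most 3 k 2^l, and 3 * 7/3 = 7. *)
apply: (@le_trans _ _ (\sum_(0 <= l < n) 3 * k%:R * (p_dist nu k l * 2 ^+ l))).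
  apply: ler_sum => l _; rewrite mulrCA ler_wpM2l ?(ltW (p_dist_gt0 _))//.
  have /andP[_] := htau l; rewrite /level_cost exprS; lra.
rewrite -big_distrr/=; have := p_dist_sum_exp2 n.
rewrite -(ler_pM2l (x := 3 * k%:R)) ?mulr_gt0 ?ltr0n//; lra.
Unshelve. all: by end_near. Qed.

(** The constant 32 is 8 + 16 + 8: level 0 has weight at least 1/2, level 1 has weight at least 1/4
    and k nu(k) <= 4 nubar(j)^2, and the remaining levels telescope. *)
Lemma level_second_moments (j n : nat) (c : nat -> R) : (2 * j <= k)%N ->
  c 0%N <= 4 * nubar j ^+ 2 / k%:R -> c 1%N <= nu k ->
  (forall l, c l.+2 <= nu (k * 2 ^ l.+1)) ->
  \sum_(0 <= l < n.+2) c l / p_dist nu k l <= 32 * nubar j ^+ 2 / k%:R.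
Proof.
move=> jk c0 c1 c2; have k0 : 0 < k%:R :> R by rewrite ltr0n.
have /andP[p1 _] := p_one_bounds.
have p1_gt0 : 0 < p_one nu k by apply: lt_le_trans p1; rewrite invr_gt0.
have b0 := nubar_gt0 nu_pos nu_sum.
have jk' : (j <= k)%N by lia.
have nuk : k%:R * nu k <= 4 * nubar j ^+ 2.
  have half : 2^-1 * k%:R <= (k - j)%:R :> R.
    by rewrite -(ler_pM2l (x := 2)) // mulrA mulfV// mul1r -natrM ler_nat; lia.
  have := @sqr_nubar_diff_ge j k 2^-1 jk' k_gt0 _ half; rewrite invr_ge0 => /(_ (ler0n _ 2)).
  have : (nubar j - nubar k) ^+ 2 <= nubar j ^+ 2.
    have := nubar_le nu_pos nu_sum jk'; have := b0 k; have := b0 j; nra.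
  rewrite exprVn; lra.
rewrite 2?big_nat_recl//=.
have t0 : c 0%N / (2 * p_one nu k) <= 8 * nubar j ^+ 2 / k%:R.
  rewrite ler_pdivrMr; last by rewrite mulr_gt0.
  apply: (le_trans c0).
  have : 0 <= nubar j ^+ 2 / k%:R by rewrite divr_ge0 ?sqr_ge0 ?ltW.
  by rewrite -[4 * _ / _]mulrA -[8 * _ / _]mulrA; move: (_ / _) => x x0; nra.
have t1 : c 1%N / p_one nu k <= 16 * nubar j ^+ 2 / k%:R.
  rewrite ler_pdivrMr//; apply: (le_trans c1).
  have : nu k <= 4 * (nubar j ^+ 2 / k%:R) by rewrite mulrA ler_pdivlMr// mulrC.
  have : 0 <= nubar j ^+ 2 / k%:R by rewrite divr_ge0 ?sqr_ge0 ?ltW.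
  by rewrite -[16 * _ / _]mulrA; move: (_ / _) => x x0; nra.
(* The numerator is at most 8 (D l)^2 / (k 2^(l+2)); the weight, proportional to [D l], cancels one
   of the two factors. *)
have t2 l : c l.+2 / p_tail nu k l.+2 <= 8 * nubar k / k%:R * D l.
  have D0 := nubar_dyadic_gt0 l.
  have k2 : (0 < k * 2 ^ l.+1)%N by rewrite muln_gt0 k_gt0 expn_gt0.
  have kl : (k * 2 ^ l <= k * 2 ^ l.+1)%N by rewrite leq_mul2l leq_exp2l// leqnSn orbT.
  have half : 2^-1 * (k * 2 ^ l.+1)%:R <= (k * 2 ^ l.+1 - k * 2 ^ l)%:R :> R.
    rewrite -(ler_pM2l (x := 2)) // mulrA mulfV// mul1r -natrM ler_nat.
    by rewrite expnS; lia.
  have := @sqr_nubar_diff_ge _ _ 2^-1 kl k2 _ half; rewrite invr_ge0 => /(_ (ler0n _ 2)).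
  rewrite natrM natrX exprVn => le.
  have e0 : 0 < 2 ^+ l.+2 :> R by rewrite exprn_gt0.
  have bk := b0 k.
  rewrite p_tailE ler_pdivrMr; last by rewrite divr_gt0// mulr_gt0.
  rewrite (_ : _ * (_ / _) = 8 * D l ^+ 2 / (k%:R * 2 ^+ l.+2)); last first.
    by field; rewrite !gt_eqF.
  rewrite ler_pdivlMr ?(mulr_gt0 k0 e0)//.
  apply: (@le_trans _ _ (nu (k * 2 ^ l.+1)%N * (k%:R * 2 ^+ l.+2))).
    by rewrite ler_wpM2r// mulr_ge0 ?(ltW k0) ?(ltW e0).
  by rewrite (exprS _ l.+1); lra.
have t2s : \sum_(0 <= l < n) c l.+2 / p_tail nu k l.+2 <= 8 * nubar j ^+ 2 / k%:R.
  apply: (@le_trans _ _ (\sum_(0 <= l < n) 8 * nubar k / k%:R * D l)).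
    by apply: ler_sum => i _; exact: t2.
  rewrite -big_distrr/=; apply: (@le_trans _ _ (8 * nubar k / k%:R * nubar k)).
    by rewrite ler_wpM2l ?nubar_dyadic_sum// divr_ge0 ?(ltW k0)// mulr_ge0 ?(ltW (b0 k)).
  rewrite mulrAC ler_pM2r ?invr_gt0// -mulrA ler_pM2l// -expr2.
  by rewrite ler_sqr ?nnegrE ?(ltW (b0 _)) ?nubar_le.
lra.
Qed.

End estimator_parameters.

(** * Variance of blocks of arbitrary length *)

Section block_variance_bound.
Context (R : realType) (nu : nat -> R).
Hypotheses (nu_pos : forall i, 0 < nu i)
  (nu_decr : forall i j : nat, (i <= j)%N -> nu j <= nu i)
  (nu_sum : cvgn (series (nu_term nu))).
Context d (T : measurableType d) (P : probability T R).
Variable Y : int -> nat -> T -> R.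
Hypotheses (Y2 : forall m n, Y m n \in Lfun P 2%:E)
  (Y0 : forall m, exists c, Y m 0%N = cst c)
  (YB : forall m (l n : nat),
    rms P (Y (m + l%:Z) (l + n) - Y m n)%R <= Num.sqrt (nu n))
  (YM : forall m n m' n', (n%:Z - m <= - m')%R ->
    mean P (Y m n * Y m' n')%R = mean P (Y m n) * mean P (Y m' n')).

Lemma sd_block m a n :
  sd P (\sum_(0 <= i < n) Y m (i + a)%N)%R <= 5 * nubar nu 0 * Num.sqrt n%:R.
Proof.
have B0 := nubar_gt0 nu_pos nu_sum 0.
have [->|n0] := posnP n.
  rewrite big_nil sdE (mean_cst P 0) subrr.
  rewrite /rms expr2 mul0r (expectation_cst P 0) sqrtr0.
  by rewrite !mulr_ge0 ?sqrtr_ge0 ?(ltW B0).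
have /andP[rn nr] := trunc_log_bounds (ltnSn 1) n0.
apply: (le_trans (sd_block_dyadic nu_pos Y2 Y0 YB YM m a (ltnW nr))).
apply: (le_trans (dyadic_bound_le nu_pos nu_sum _)).
(* The power of two just above n is at most 2n, and (7/2)^2 * 2 = 49/2 is below 5^2. *)
rewrite -ler_sqr ?nnegrE ?mulr_ge0 ?sqrtr_ge0 ?(ltW B0)//.
rewrite !exprMn !sqr_sqrtr ?exprn_ge0//.
have : (2 : R) ^+ (trunc_log 2 n).+1 <= 2 * n%:R.
  by rewrite exprS; move: rn; rewrite -(ler_nat R) natrX; lra.
have : 0 < nubar nu 0 ^+ 2 by rewrite exprn_gt0.
have : 0 <= n%:R :> R by rewrite ler0n.
move: (nubar nu 0 ^+ 2) (2 ^+ (trunc_log 2 n).+1) (n%:R) => x y z z0 x0 yz.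
have := mulr_ge0 (ltW x0) z0; have : x * y <= x * (2 * z) by rewrite ler_pM2l.
lra.
Qed.

End block_variance_bound.

(** * Time averages *)

Section time_averages.
Context (R : realType) (nu : nat -> R).
Hypotheses (nu_pos : forall i, 0 < nu i)
  (nu_decr : forall i j : nat, (i <= j)%N -> nu j <= nu i)
  (nu_sum : cvgn (series (nu_term nu))).
Context d (T : measurableType d) (P : probability T R).
Variable Y : int -> nat -> T -> R.
Hypotheses (Y2 : forall m n, Y m n \in Lfun P 2%:E)
  (Y0 : forall m, exists c, Y m 0%N = cst c)
  (Ymean : forall m n, mean P (Y m n) = mean P (Y 0 n))
  (YB : forall m (l n : nat),
    rms P (Y (m + l%:Z) (l + n) - Y m n)%R <= Num.sqrt (nu n))
  (YM : forall m n m' n', (n%:Z - m <= - m')%R ->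
    mean P (Y m n * Y m' n')%R = mean P (Y m n) * mean P (Y m' n')).

(** [Y] counts steps, so the index i + M for a start at time -M is the time i, as in X_{i,M}. *)
Definition block_avg (M b k : nat) : T -> R :=
  fun w => (k - b)%:R^-1 * (\sum_(b <= i < k) Y M%:Z (i + M)%N)%R w.

Lemma block_sum_Lfun2 M b k : (\sum_(b <= i < k) Y M%:Z (i + M)%N)%R \in Lfun P 2%:E.
Proof. exact: Lfun2_sum. Qed.

Lemma block_avg_Lfun2 M b k : block_avg M b k \in Lfun P 2%:E.
Proof. by apply: Lfun2Z; exact: block_sum_Lfun2. Qed.

Lemma mean_block_avg M b k :
  mean P (block_avg M b k) =
  (k - b)%:R^-1 * \sum_(b <= i < k) mean P (Y 0 (i + M)%N).
Proof.
rewrite meanZ ?mean_sum//; last exact/Lfun21/block_sum_Lfun2.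
by congr (_ * _); apply: eq_bigr => i _; rewrite Ymean.
Qed.

Lemma sd_block_sum M b k :
  sd P (\sum_(b <= i < k) Y M%:Z (i + M)%N)%R <=
  5 * nubar nu 0 * Num.sqrt (k - b)%:R.
Proof.
rewrite -{1}[b]add0n big_addn; under eq_bigr do rewrite -addnA.
exact: (sd_block nu_pos nu_sum Y2 Y0 YB YM).
Qed.

Lemma sd_block_avg M b k : (b < k)%N ->
  sd P (block_avg M b k) * Num.sqrt (k - b)%:R <= 5 * nubar nu 0.
Proof.
move=> bk; have n0 : 0 < (k - b)%:R :> R by rewrite ltr0n subn_gt0.
rewrite sdZ ?block_sum_Lfun2// gtr0_norm ?invr_gt0//.
have s0 : 0 < Num.sqrt (k - b)%:R :> R by rewrite sqrtr_gt0.
rewrite -[X in X^-1]sqr_sqrtr ?(ltW n0)//.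
rewrite -mulrA mulrC ler_pdivrMr ?exprn_gt0// expr2 mulrA ler_pM2r//.
exact: sd_block_sum.
Qed.

Lemma rms_block_avgB (M l b k : nat) :
  rms P (block_avg (M + l) b k - block_avg M b k)%R <=
  (k - b)%:R^-1 * \sum_(b <= i < k) Num.sqrt (nu (i + M)%N).
Proof.
have -> : (block_avg (M + l) b k - block_avg M b k)%R =
    (fun w => (k - b)%:R^-1 * (\sum_(b <= i < k)
       (Y (M + l)%N%:Z (i + (M + l))%N - Y M%:Z (i + M)%N))%R w).
  by apply/funext => w; rewrite sumrB !fctE /block_avg mulrBr.
rewrite rmsZ; last by apply: Lfun2_sum => i; exact: Lfun2B.
rewrite ger0_norm ?invr_ge0// ler_wpM2l ?invr_ge0//.
apply: (le_trans (rms_sum _ _)); first by move=> i; exact: Lfun2B.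
apply: ler_sum => i _; have := YB M%:Z l (i + M).
by rewrite PoszD (addnCA l) (addnC l).
Qed.

(** Means do not depend on the starting time, so the later mean is also that of a chain which
    started n - h units earlier and is coupled with [Y 0 h]. *)
Lemma mean_fchain_cauchy (n h : nat) : (h <= n)%N ->
  `|mean P (Y 0 n) - mean P (Y 0 h)| <= Num.sqrt (nu h).
Proof.
move=> hn; have := YB 0 (n - h) h; rewrite subnK// add0r; apply: le_trans.
have -> : mean P (Y 0 n) - mean P (Y 0 h) = mean P (Y (n - h)%:Z n - Y 0 h)%R.
  by rewrite meanB ?Ymean//; exact: Lfun21.
by apply: mean_le_rms; exact: Lfun2B.
Qed.

Lemma is_cvg_mean_fchain : cvgn (fun n => mean P (Y 0 n)).
Proof.
apply: cauchy_cvg; apply/cauchy_exP => e e0.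
have : \forall h \near \oo, Num.sqrt (nu h) < e.
  have := cvg_sqrt_nu nu_pos nu_decr nu_sum.
  move/cvgrPdist_lt => /(_ e e0); apply: filterS => h.
  by rewrite sub0r normrN ger0_norm ?sqrtr_ge0.
move=> [h _ /(_ h (leqnn h)) he]; exists (mean P (Y 0 h)).
exists h => // n hn; rewrite /ball/= distrC; apply: le_lt_trans he.
exact: mean_fchain_cauchy.
Qed.

(** With n and n' the lengths from b and from b', the shorter average is n/n' times the longer one
    minus 1/n' times the dropped sum. Both lengths are at least k/2, and n - n' = s^2 k with s <= 1,
    so both corrections are of order s. *)
Lemma sd_block_avg_drop (b b' k : nat) : (b <= b')%N -> (2 * b' <= k)%N -> (0 < k)%N ->
  k%:R * sd P (block_avg 0 b' k) ^+ 2 <= 50 * nubar nu 0 ^+ 2 /\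
  k%:R * sd P (block_avg 0 b' k) ^+ 2 <= k%:R * sd P (block_avg 0 b k) ^+ 2
    + 1000 * nubar nu 0 ^+ 2 * Num.sqrt ((b' - b)%:R / k%:R).
Proof.
move=> bb' b'k k0.
have bk : (b' <= k)%N by lia.
have kbE : ((k - b) = (k - b') + (b' - b))%N by lia.
pose K : R := k%:R; have K0 : 0 < K by rewrite ltr0n.
pose r := Num.sqrt K; have r0 : 0 < r by rewrite sqrtr_gt0.
have r2 : r ^+ 2 = K by rewrite sqr_sqrtr// ltW.
have B0 := nubar_gt0 nu_pos nu_sum 0.
have half c : (2 * c <= k)%N -> K <= 2 * (k - c)%:R.
  by move=> ck; rewrite -natrM ler_nat; lia.
have sdc c : (2 * c <= k)%N -> (r * sd P (block_avg 0 c k)) ^+ 2 <= 50 * nubar nu 0 ^+ 2.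
  move=> ck; have ck' : (c < k)%N by lia.
  have S0 : 0 <= sd P (block_avg 0 c k) * Num.sqrt (k - c)%:R.
    by rewrite mulr_ge0 ?sd_ge0 ?sqrtr_ge0.
  have le := sd_block_avg 0 ck'; have := ler_pM S0 S0 le le.
  rewrite -!expr2 !exprMn r2 [Num.sqrt (k - c)%:R ^+ 2]sqr_sqrtr//.
  have := half _ ck; have := sqr_ge0 (sd P (block_avg 0 c k)).
  by move: (sd _ _ ^+ 2) ((k - c)%:R) => x y x0 Ky; have := ler_wpM2r x0 Ky; lra.
have Bb' := sdc _ b'k; have Bb : (r * sd P (block_avg 0 b k)) ^+ 2 <= 50 * nubar nu 0 ^+ 2.
  by apply: sdc; lia.
rewrite -/K; split; first by rewrite -r2 -exprMn.
rewrite -[in X in X <= _]r2 -[in X in _ <= X + _]r2 -!exprMn.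
set x := sd P _ in Bb' *; set v := sd P _ in Bb *.
pose s := Num.sqrt ((b' - b)%:R / K).
have s0 : 0 <= s by exact: sqrtr_ge0.
have dlt : (b' - b)%:R <= K :> R by rewrite ler_nat; lia.
have s1 : s <= 1 by rewrite -sqrtr1 ler_wsqrtr// ler_pdivrMr// mul1r.
have s2 : s ^+ 2 * K = (b' - b)%:R.
  by rewrite sqr_sqrtr ?divr_ge0 ?ler0n ?(ltW K0)// divfK// gt_eqF.
have sr : Num.sqrt (b' - b)%:R = s * r.
  by rewrite -s2 -r2 -exprMn sqrtr_sqr ger0_norm// mulr_ge0// ltW.
set n : R := (k - b)%:R; set n' : R := (k - b')%:R.
have n'K : K <= 2 * n' by exact: half.
have n'0 : 0 < n' by lra.
have nn' : n = n' + s ^+ 2 * K.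
  by rewrite s2 /n /n' -natrD -kbE.
(* 15/2 is a rational upper bound for sqrt 50. *)
have rv : r * v <= 15 / 2 * nubar nu 0.
  rewrite -ler_sqr ?nnegrE ?mulr_ge0 ?sd_ge0 ?(ltW r0) ?(ltW B0)//.
  apply: (le_trans Bb); rewrite exprMn; have := exprn_gt0 2 B0; lra.
have v0 : 0 <= v by exact: sd_ge0.
have xle : x <= n / n' * v + n'^-1 * (5 * nubar nu 0 * (s * r)).
  pose A := (\sum_(b <= i < b') Y 0 (i + 0)%N)%R.
  have -> : x = sd P ((fun w => n / n' * block_avg 0 b k w) + (fun w => - n'^-1 * A w))%R.
    rewrite /x; congr sd; apply/funext => w; rewrite !fctE /block_avg -/n -/n' /A.
    rewrite (big_cat_nat bb' bk) /=.
    have n0 : n != 0 by rewrite gt_eqF// nn' ltr_pwDl// mulr_ge0 ?sqr_ge0 ?ltW.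
    by rewrite !fctE; field; rewrite n0 gt_eqF.
  have A2 : A \in Lfun P 2%:E by exact: Lfun2_sum.
  have avg2 := block_avg_Lfun2 0 b k.
  apply: (le_trans (sdD _ _)); try exact: Lfun2Z.
  rewrite (sdZ (n / n') avg2) (sdZ (- n'^-1) A2).
  rewrite normrN !ger0_norm ?invr_ge0 ?divr_ge0 ?ler0n//.
  rewrite lerD2l ler_wpM2l ?invr_ge0 ?ler0n// -sr; exact: (sd_block_sum 0).
(* 25 = 15 + 10: rescaling by n/n' costs at most 2 s^2 * 15/2, the dropped sum at most 5 * 2 s, in
   units of [nubar nu 0]. *)
have key : r * x <= r * v + 25 * nubar nu 0 * s.
  have h1 : r * x * n' <= n * (r * v) + 5 * nubar nu 0 * s * K.
    rewrite -r2; have := ler_wpM2l (ltW (mulr_gt0 r0 n'0)) xle.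
    rewrite (_ : r * n' * x = r * x * n'); last by ring.
    rewrite (_ : r * n' * (_ + _) = n * (r * v) + 5 * nubar nu 0 * s * r ^+ 2)//.
    by field; rewrite gt_eqF.
  rewrite -(ler_pM2r n'0); apply: (le_trans h1); rewrite nn'.
  have h2 : s ^+ 2 * K * (r * v) <= s * (2 * n') * (15 / 2 * nubar nu 0).
    rewrite ler_pM ?mulr_ge0 ?sqr_ge0 ?(ltW K0) ?(ltW r0)// ler_pM ?sqr_ge0 ?(ltW K0)//.
    by rewrite expr2 ler_piMl.
  have h3 : 5 * nubar nu 0 * s * K <= 5 * nubar nu 0 * s * (2 * n').
    by rewrite ler_wpM2l// !mulr_ge0 ?(ltW B0).
  lra.
have x0 : 0 <= r * x by rewrite mulr_ge0 ?sd_ge0 ?(ltW r0).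
(* Expanding the square gives 2 * 15/2 * 25 + 25^2 = 1000, since s^2 <= s. *)
apply: (@le_trans _ _ ((r * v + 25 * nubar nu 0 * s) ^+ 2)).
  by rewrite ler_sqr ?nnegrE// (le_trans x0).
rewrite sqrrD -addrA lerD2l -/s.
have h4 : r * v * (25 * nubar nu 0 * s) <= 15 / 2 * nubar nu 0 * (25 * nubar nu 0 * s).
  by rewrite ler_wpM2r// !mulr_ge0 ?(ltW B0).
have h5 : (nubar nu 0 * s) ^+ 2 <= nubar nu 0 ^+ 2 * s.
  by rewrite exprMn ler_wpM2l ?sqr_ge0// expr2 ler_piMl.
rewrite -mulr_natl; lra.
Qed.

End time_averages.

(** * Randomised estimators *)

Section randomised_estimators.
Context d (T : measurableType d) (R : realType) (P : probability T R).

Lemma indep_RV_comp d1 (T1 : measurableType d1) d2 (T2 : measurableType d2)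
    d3 (T3 : measurableType d3) d4 (T4 : measurableType d4)
    (X : T -> T1) (Y : T -> T2) (h : T1 -> T3) (h' : T2 -> T4) :
  measurable_fun [set: T1] h -> measurable_fun [set: T2] h' ->
  indep_RV P X Y -> indep_RV P (h \o X) (h' \o Y).
Proof.
move=> mh mh'; apply: indep_systemsS => _ [A mA <-].
  by exists (h @^-1` A) => //; rewrite -[X in measurable X]setTI; exact: mh.
by exists (h' @^-1` A) => //; rewrite -[X in measurable X]setTI; exact: mh'.
Qed.

Lemma indic_Lfun1 (A : set T) : measurable A -> (\1_A : T -> R) \in Lfun P 1.
Proof.
move=> mA; apply/Lfun1_integrable; exact: integrable_indic.
Qed.

Section single_term.
Variables (N : {RV P >-> nat}) (p : nat -> R) (D : nat -> T -> R).
Hypotheses (p_gt0 : forall l, 0 < p l)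
  (N_law : forall l, P (N @^-1` [set l]) = (p l)%:E)
  (D2 : forall l, D l \in Lfun P 2%:E)
  (ND : forall l, indep_RV P N (D l)).

Definition single_term (w : T) : R := D (N w) w / p (N w).

Let mN l : measurable (N @^-1` [set l]).
Proof. by rewrite -[X in measurable X]setTI; exact: measurable_funP. Qed.

Lemma measurable_single_term : measurable_fun setT single_term.
Proof.
move=> _ A mA; rewrite setTI.
rewrite (_ : _ @^-1` _ = \bigcup_l (N @^-1` [set l] `&` (fun w => D l w / p l) @^-1` A)).
  apply: bigcupT_measurable => l; apply: measurableI; first exact: mN.
  rewrite -[X in measurable X]setTI.
  suff : measurable_fun setT (fun w => D l w / p l) by apply.
  by apply: measurable_funM => //; exact: Lfun_measurable (D2 l).
apply/seteqP; split=> [w Aw|w [l _ [/= Nl Al]]]; first by exists (N w).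
by rewrite /= /single_term Nl.
Qed.

Lemma integral_single_term (h : R -> R) l : measurable_fun [set: R] h ->
  (h \o (fun w => D l w / p l)) \in Lfun P 1 ->
  (\int[P]_(w in N @^-1` [set l]) (h (single_term w))%:E =
   (p l * mean P (h \o (fun w => D l w / p l)))%:E)%E.
Proof.
move=> mh h1.
rewrite integral_mkcond.
transitivity ('E_P[(\1_(N @^-1` [set l]) * (h \o (fun w => D l w / p l)))%R])%E.
  rewrite unlock; apply: eq_integral => w _; rewrite patchE /=.
  rewrite fctE indicE; case: ifPn => Nw; last by rewrite mul0r.
  by rewrite mul1r /single_term; move: Nw; rewrite inE /= => ->.
have [] // := expectation_indepM (indic_Lfun1 (mN l)) h1.
  have -> : \1_(N @^-1` [set l]) = (\1_[set l] : nat -> R) \o N :> (T -> R).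
    by apply/funext => w; rewrite /= !indicE.
  have mh' : measurable_fun [set: R] (fun x => h (x / p l)).
    by apply: (measurableT_comp mh); exact: measurable_funM.
  have m1 : measurable_fun [set: nat] (\1_[set l] : nat -> R) by [].
  exact: (indep_RV_comp m1 mh' (@ND l)).
move=> _ ->; rewrite expectation_indic// N_law EFinM -meanE//.
Qed.

Let cover : \bigcup_l N @^-1` [set l] = setT.
Proof. by apply/seteqP; split => // w _; exists (N w). Qed.

Let trivN : trivIset setT (fun l => N @^-1` [set l]).
Proof. by move=> i j _ _ [w [/= <- <-]]. Qed.

Let DpL2 l : (fun w => D l w / p l) \in Lfun P 2%:E.
Proof.
rewrite (_ : (fun _ => _) = (fun w => (p l)^-1 * D l w)); first exact: Lfun2Z.
by apply/funext => w; rewrite mulrC.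
Qed.

Let sqrDp l : mean P ((fun x => x ^+ 2) \o (fun w => D l w / p l)) =
  mean P (D l ^+ 2) / p l ^+ 2.
Proof.
rewrite mulrC -meanZ; last exact: Lfun2_sqr.
by congr mean; apply/funext => w; rewrite !fctE /= exprMn exprVn mulrC.
Qed.

(** On the event N = l, of probability p_l and independent of [D l], the square carries 1/p_l^2; one
    of the two factors is cancelled by the probability. *)
Lemma single_term_Lfun2 C :
  (forall n, \sum_(0 <= l < n) mean P (D l ^+ 2) / p l <= C) ->
  single_term \in Lfun P 2%:E /\ mean P (single_term ^+ 2) <= C.
Proof.
move=> sumC.
have le : (\int[P]_w (single_term w ^+ 2)%:E <= C%:E)%E.
  rewrite -cover ge0_integral_bigcup//; last first.
  - by move=> w _; rewrite lee_fin sqr_ge0.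
  - rewrite cover; apply/measurable_EFinP; apply: measurable_funX.
    exact: measurable_single_term.
  apply: lime_le.
    by apply: is_cvg_nneseries => l _ _; apply: integral_ge0 => w _; rewrite lee_fin sqr_ge0.
  near=> n; rewrite (eq_bigr (fun l => (mean P (D l ^+ 2) / p l)%:E)).
    by rewrite sumEFin lee_fin.
  move=> l _; rewrite (integral_single_term (h := fun x => x ^+ 2)).
  - rewrite sqrDp; congr EFin; field; rewrite gt_eqF//.
  - exact: exprn_measurable.
  - exact: (Lfun2_sqr (DpL2 l)).
have Z2 : single_term \in Lfun P 2%:E.
  apply/Lfun2P; split; first exact: measurable_single_term.
  apply/integrableP; split.
    apply/measurable_EFinP; rewrite expr2.
    by apply: measurable_funM; exact: measurable_single_term.
  rewrite (eq_integral (fun w => (single_term w ^+ 2)%:E)).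
    by apply: le_lt_trans le _; rewrite ltry.
  by move=> w _ /=; rewrite ger0_norm// sqr_ge0.
split => //; rewrite -lee_fin -meanE ?Lfun2_sqr//.
by rewrite unlock.
Unshelve. all: by end_near. Qed.

(** Square-integrability is what justifies summing the integral over the values of [N]; on each of
    them the weight p_l cancels completely. *)
Lemma mean_single_term (m : R) : single_term \in Lfun P 2%:E ->
  \sum_(0 <= l < n) mean P (D l) @[n --> \oo] --> m -> mean P single_term = m.
Proof.
move=> Z2 cvm; apply: EFin_inj; rewrite -meanE ?Lfun21// unlock -cover.
rewrite integral_bigcup//; last by rewrite cover; exact/Lfun1_integrable/Lfun21.
rewrite (eq_eseriesr (g := fun l => (mean P (D l))%:E)).
  apply/cvg_lim => //; under eq_fun do rewrite sumEFin.
  by apply: cvg_EFin => //; exact: nearW.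
move=> l _; rewrite (integral_single_term (h := id))//; last exact: (Lfun21 (DpL2 l)).
rewrite (_ : id \o _ = (fun w => (p l)^-1 * D l w)).
  by rewrite meanZ ?Lfun21// mulVKf// gt_eqF.
by apply/funext => w /=; rewrite mulrC.
Qed.

End single_term.

Section thinned_correction.
Variables (X : T -> R) (Z : {RV P >-> R}) (Q : {RV P >-> bool}) (q : R).
Hypotheses (q_gt0 : 0 < q) (X2 : X \in Lfun P 2%:E)
  (Z2 : (Z : T -> R) \in Lfun P 2%:E)
  (Q_law : P (Q @^-1` [set true]) = q%:E)
  (ZX : indep_RV P Z X) (QXZ : indep_RV P Q (fun w => (X w, Z w))).

Let B : T -> R := fun w => (Q w)%:R.
Let W : T -> R := fun w => q^-1 * (Q w)%:R * Z w.

Let BE : B = \1_(Q @^-1` [set true]).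
Proof.
apply/funext => w; rewrite /B indicE; case E: (Q w); first by rewrite mem_set.
by rewrite memNset//= E.
Qed.

Let mQ : measurable (Q @^-1` [set true]).
Proof. by rewrite -[X in measurable X]setTI; exact: measurable_funP. Qed.

Let mean_thin (h : R * R -> R) : measurable_fun [set: R * R] h ->
  (fun w => h (X w, Z w)) \in Lfun P 1 ->
  (B * (fun w => h (X w, Z w)))%R \in Lfun P 1 /\
  mean P (B * (fun w => h (X w, Z w)))%R = q * mean P (fun w => h (X w, Z w)).
Proof.
move=> mh h1; have B1 : B \in Lfun P 1 by rewrite BE; exact: indic_Lfun1.
have := expectation_indepM B1 h1; case => [|? EE].
  exact: (indep_RV_comp (h := fun b : bool => b%:R : R) (h' := h) _ mh QXZ).
split => //; rewrite /mean EE fineM ?expectation_fin_num//.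
by rewrite {1}BE expectation_indic// Q_law.
Qed.

Let thin_sqr : (W ^+ 2)%R = (fun w => q ^- 2 * (B * (Z ^+ 2)) w)%R.
Proof.
apply/funext => w; rewrite !fctE /W /B; case: (Q w); rewrite ?mulr1 ?mul1r.
  by rewrite exprMn exprVn.
by rewrite mulr0 !mul0r mulr0 expr0n.
Qed.

(** Since Q^2 = Q, thinning multiplies the second moment by 1/q only, while the mean is preserved.
    Independence of [Q] from the pair keeps the correction uncorrelated with [X], so the variances
    add. *)
Lemma thinned_estimator :
  [/\ (fun w => X w + q^-1 * (Q w)%:R * Z w) \in Lfun P 2%:E,
      mean P (fun w => X w + q^-1 * (Q w)%:R * Z w) = mean P X + mean P Z &
      sd P (fun w => X w + q^-1 * (Q w)%:R * Z w) ^+ 2 <=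
        sd P X ^+ 2 + q^-1 * mean P (Z ^+ 2)%R].
Proof.
have mX := Lfun_measurable X2.
have [BZ1 BZE] := mean_thin (h := snd) (measurable_snd) (Lfun21 Z2).
have [BZ2 BZ2E] := mean_thin (h := fun z => z.2 ^+ 2)
  (measurable_funX _ measurable_snd) (Lfun2_sqr Z2).
have [BXZ BXZE] := mean_thin (h := fun z => z.1 * z.2)
  (measurable_funM measurable_fst measurable_snd) (Lfun2M X2 Z2).
have mW : measurable_fun setT W.
  apply: measurable_funM => //; apply: measurable_funM => //.
  exact: (measurableT_comp (f := fun b : bool => b%:R : R)).
have W2 : W \in Lfun P 2%:E.
  apply/Lfun2P; split => //; apply/Lfun1_integrable.
  by rewrite thin_sqr; exact: Lfun1Z.
have meanW : mean P W = mean P Z.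
  rewrite (_ : W = (fun w => q^-1 * (B * (fun w => (X w, Z w).2)) w)).
    by rewrite meanZ// BZE mulKf// gt_eqF.
  by apply/funext => w; rewrite /W mulrA.
have meanXW : mean P (X * W)%R = mean P X * mean P W.
  rewrite meanW (_ : X * W = (fun w => q^-1 * (B * (fun w => (X w, Z w).1 * (X w, Z w).2)) w)).
    by rewrite meanZ// BXZE mulKf ?gt_eqF// mulrC -mean_indepM// mulrC.
  by apply/funext => w; rewrite /W !fctE /= /B; ring.
have -> : (fun w => X w + q^-1 * (Q w)%:R * Z w) = (X + W)%R by [].
split; first exact: Lfun2D.
  by rewrite meanD ?meanW//; exact: Lfun21.
rewrite sd_sqrD// lerD2l; apply: (@le_trans _ _ (rms P W ^+ 2)).
  by rewrite ler_sqr ?nnegrE ?sd_ge0 ?rms_ge0// sd_le_rms.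
rewrite rms_sqr thin_sqr meanZ// BZ2E.
have e m : q ^- 2 * (q * m) = q^-1 * m by field; rewrite gt_eqF.
by rewrite e.
Qed.

End thinned_correction.

End randomised_estimators.

(** * Chain averages as block averages, and their limit in mean *)

Section chain_averages.
Context (R : realType) (dO dF dF' : measure_display)
    (Omega : measurableType dO) (F : measurableType dF)
    (F' : measurableType dF')
    (P : probability Omega R)
    (g : F * F' -> F) (mg : measurable_fun [set: F * F'] g)
    (U : int -> {RV P >-> F'}) (x0 : F)
    (f : F -> R) (mf : measurable_fun [set: F] f).
Local Notation Y := (fchain g U x0 f).

Lemma time_avgE b k (M : nat) :
  time_avg g U x0 f b k M%:Z = block_avg Y M b k.
Proof. by apply/funext => w; rewrite /time_avg /block_avg fct_sumE. Qed.

Lemma adapted_block_avg M b k : adapted U setT (block_avg Y M b k).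
Proof.
apply/adaptedP; apply: measurable_funM => //; rewrite fct_sumE.
apply: measurable_sum => i.
have /adaptedP // : adapted U setT (Y M (i + M)%N).
by apply: (adaptedS _ (@adapted_fchain _ _ _ _ _ _ _ _ _ mg U x0 _ mf M (i + M)%N)).
Qed.

End chain_averages.

(** The window has a fixed length and moves to infinity, so a finite sum of limits suffices. *)
Lemma cvg_mean_shift (R : realType) (e : nat -> R) (m : R) (b k : nat) (M : nat -> nat) :
  (b < k)%N -> (forall n, (n <= M n)%N) -> e n @[n --> \oo] --> m ->
  (k - b)%:R^-1 * \sum_(b <= i < k) e (i + M n)%N @[n --> \oo] --> m.
Proof.
move=> bk Mn em.
have k0 : (k - b)%:R != 0 :> R by rewrite pnatr_eq0 -lt0n subn_gt0.
have cv : (\sum_(b <= i < k) e (i + M n)%N) @[n --> \oo] --> \sum_(b <= i < k) m.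
  apply: cvg_big => [|i _]; first exact: add_continuous.
  apply: (@cvg_comp _ _ _ (fun n => (i + M n)%N) e \oo \oo) => //.
  apply/cvgnyPge => A; near=> n.
  have An : (A <= n)%N by near: n; exact: nbhs_infty_ge.
  by rewrite (leq_trans An)// (leq_trans (Mn n))// leq_addl.
have mE : m = (k - b)%:R^-1 * \sum_(b <= i < k) m.
  by rewrite sumr_const_nat -[m *+ _]mulr_natl mulKf.
rewrite [X in _ --> X]mE.
by apply: cvgM; [exact: cvg_cst|exact: cv].
Unshelve. all: by end_near. Qed.

(** * Bias, cost and variance of the estimator *)

Theorem theorem3p2 (R : realType)
    (dO dF dF' : measure_display)
    (Omega : measurableType dO) (F : measurableType dF)
    (F' : measurableType dF')
    (P : probability Omega R)
    (g : F * F' -> F) (mg : measurable_fun [set: F * F'] g)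
    (U : int -> {RV P >-> F'}) (iidU : iid P U)
    (x0 : F)
    (f : F -> R) (mf : measurable_fun [set: F] f)
    (f2 : forall i : nat, f \o chain g U x0 i%:Z 0 \in Lfun P 2%:E)
    (b b' : nat -> nat)
    (hb : forall k : nat, (0 < k)%N -> (b k <= b' k)%N && (2 * b' k <= k)%N)
    (tau : nat -> nat -> R)
    (htau : forall k l : nat, (0 < k)%N ->
       0 <= tau k l <= level_cost R k l.+1 + level_cost R k l)
    (nu : nat -> R)
    (nu_pos : forall i : nat, 0 < nu i)
    (nu_decr : forall i j : nat, (i <= j)%N -> nu j <= nu i)
    (nu_sum : cvgn (series (nu_term nu)))
    (nu_bound : forall i m : nat,
       ('E_P[fun w => ((f (chain g U x0 i%:Z m%:Z w)
                        - f (chain g U x0 i%:Z 0 w)) ^+ 2)%R] <= (nu i)%:E)%E)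
    (k : nat) (k_gt0 : (0 < k)%N)
    (N : {RV P >-> nat})
    (N_law : forall l : nat, P (N @^-1` [set l]) = (p_dist nu k l)%:E)
    (N_indep : indep_RV_family P N U)
    (Z' : {RV P >-> R})
    (Z'_law : same_law P Z' (Z_est g U x0 f b' (p_dist nu k) N k))
    (Z'_indep : indep_RV P Z' (f_level g U x0 f b' k 0))
    (Q : {RV P >-> bool})
    (Q_law : P (Q @^-1` [set true]) = (q_prob nu b' k)%:E)
    (Q_indep : indep_RV P Q (fun w => (f_level g U x0 f b' k 0 w, Z' w))) :
  let mu := lim ('E_P[f \o chain g U x0 h%:Z 0] @[h --> \oo])%E in
  let q := q_prob nu b' k in
  let fk := f_avg g U x0 f b k in
  let fhat := unbiased_est g U x0 f b' q Z' Q k in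
  let That := est_time (p_dist nu k) tau q k in
  [/\ cvg ('E_P[f \o chain g U x0 h%:Z 0] @[h --> \oo])%E
        /\ mu \is a fin_num,
      fhat \in Lfun P 2%:E,
      'E_P[fhat]%E = mu,
      (That <= (k%:R + 9 * q * k%:R)%:E)%E &
      (That * 'V_P[fhat] <=
        k%:R%:E * 'V_P[fk]
        + (8610 * nubar nu 0 ^+ 2
             * Num.max q (Num.sqrt ((b' k - b k)%:R / k%:R)))%:E)%E ].
Proof.
move=> mu q fk fhat That.
pose Y := fchain g U x0 f; pose B := nubar nu 0; pose p := p_dist nu k.
pose lvl l := f_level g U x0 f b' k l.
pose D l := (lvl l.+1 - lvl l)%R.
pose M l := (k * (2 ^ l - 1))%N.
have Y2 m n : Y m n \in Lfun P 2%:E by exact: fchain_Lfun2.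
have Ystart m : exists c, Y m 0%N = cst c by exists (f x0).
have Ymean m n : mean P (Y m n) = mean P (Y 0 n) by exact: mean_fchain.
have YB m (l n : nat) : rms P (Y (m + l%:Z) (l + n)%N - Y m n)%R <= Num.sqrt (nu n).
  exact: rms_fchainB.
have YM m n m' n' : (n%:Z - m <= - m')%R ->
    mean P (Y m n * Y m' n')%R = mean P (Y m n) * mean P (Y m' n').
  exact: mean_fchainM.
have /andP[bb' b'k] := hb k k_gt0.
have b'lt : (b' k < k)%N by lia.
have K0 : 0 < k%:R :> R by rewrite ltr0n.
have B0 : 0 < B := nubar_gt0 nu_pos nu_sum 0.
pose beta := nubar nu (b' k)./2.
have beta0 : 0 < beta := nubar_gt0 nu_pos nu_sum _.
have qB : beta = q * B by rewrite /q /q_prob divfK// gt_eqF.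
have q0 : 0 < q by rewrite divr_gt0.
have q1 : q <= 1 by rewrite ler_pdivrMr// mul1r nubar_le.
have lvlE l : lvl l = block_avg Y (M l) (b' k) k by rewrite /lvl /f_level time_avgE.
have lvl2 l : lvl l \in Lfun P 2%:E by rewrite lvlE; exact: block_avg_Lfun2.
have D2 l : D l \in Lfun P 2%:E by exact: Lfun2B.
have MS l : M l.+1 = (M l + k * 2 ^ l)%N.
  by rewrite /M expnS; have := expn_gt0 2 l; nia.
have rmsD l : rms P (D l) <=
    (k - b' k)%:R^-1 * \sum_(b' k <= i < k) Num.sqrt (nu (i + M l)%N).
  by rewrite /D !lvlE MS; exact: rms_block_avgB.
have n0 : 0 < (k - b' k)%:R :> R by rewrite ltr0n subn_gt0.
have D_far l : mean P (D l ^+ 2) <= nu (M l).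
  rewrite -rms_sqr -[leRHS]sqr_sqrtr ?(ltW (nu_pos _))//.
  rewrite ler_sqr ?nnegrE ?rms_ge0 ?sqrtr_ge0//; apply: (le_trans (rmsD l)).
  rewrite mulrC ler_pdivrMr// mulr_natr -sumr_const_nat; apply: ler_sum => i _.
  by rewrite ler_wsqrtr// nu_decr// leq_addl.
(* At level 0 the offset [M 0] is 0 and [D_far] only gives nu(0). The decay is recovered from the
   average: sqrt(nu(i)) is at most sqrt k times the i-th term of the series, and the sum starts at
   b'(k). *)
have D_near : mean P (D 0 ^+ 2) <= 4 * beta ^+ 2 / k%:R.
  have le : rms P (D 0) <= 2 / k%:R * (Num.sqrt k%:R * beta).
    apply: (le_trans (rmsD 0%N)); apply: ler_pM.
    - by rewrite invr_ge0.
    - by apply: sumr_ge0 => i _; exact: sqrtr_ge0.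
    - rewrite ler_pdivlMr// mulrC ler_pdivrMr// -natrM ler_nat; lia.
    - apply: (@le_trans _ _ (\sum_(b' k <= i < k) Num.sqrt k%:R * nu_term nu i)).
        apply: ler_sum_nat => i /andP[_ ik].
        rewrite /M expn0 subnn muln0 addn0 sqrt_nuE// mulrC.
        by rewrite ler_wpM2r ?(ltW (nu_term_gt0 nu_pos _))// ler_wsqrtr// ler_nat.
      rewrite -big_distrr/= ler_wpM2l ?sqrtr_ge0//.
      apply: (@le_trans _ _ (nubar nu (b' k))); last by apply: nubar_le => //; lia.
      by rewrite (nubar_sum nu_sum (ltnW b'lt)) lerDl ltW// nubar_gt0.
  have := ler_pM (rms_ge0 _ _) (rms_ge0 _ _) le le; rewrite -!expr2 rms_sqr.
  rewrite !exprMn sqr_sqrtr ?ler0n// => /le_trans; apply.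
  by rewrite le_eqVlt; apply/orP; left; apply/eqP; field; rewrite gt_eqF.
have p_gt0 l : 0 < p l by exact: p_dist_gt0.
have momD n : \sum_(0 <= l < n) mean P (D l ^+ 2) / p l <= 32 * beta ^+ 2 / k%:R.
  (* Two extra non-negative terms ensure that the levels 0 and 1, which have their own weights, are
     present. *)
  apply: (@le_trans _ _ (\sum_(0 <= l < n.+2) mean P (D l ^+ 2) / p l)).
    rewrite (big_cat_nat (leq0n n) (ltnW (leqnSn n.+1)))//= lerDl sumr_ge0// => l _.
    by rewrite divr_ge0 ?mean_sqr_ge0// ltW.
  apply: (level_second_moments nu_pos nu_decr nu_sum k_gt0) => //; first lia.
    by have := D_far 1%N; rewrite /M expn1 muln1.
  move=> l; apply: (le_trans (D_far _)); apply: nu_decr; rewrite /M leq_mul2l.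
  by apply/orP; right; rewrite (expnS 2 l.+1); have := expn_gt0 2 l.+1; lia.
have ND l : indep_RV P N (D l).
  apply: indep_systemsS N_indep => //.
  have /adaptedP a1 := adapted_block_avg (U := U) (x0 := x0) mg mf (M := M l.+1)
    (b := b' k) (k := k).
  have /adaptedP a2 := adapted_block_avg (U := U) (x0 := x0) mg mf (M := M l)
    (b := b' k) (k := k).
  suff : adapted U setT (D l) by [].
  by apply/adaptedP; rewrite /D !lvlE; exact: measurable_funB.
have [Z2 ZC] := single_term_Lfun2 p_gt0 N_law D2 ND momD.
(* [Z] is convertible to [single_term] for the differences [D], so the preceding moment bounds apply
   to it directly. *)
pose Z := Z_est g U x0 f b' p N k.
have mZ : measurable_fun setT Z := Lfun_measurable Z2.
pose ZR : {RV P >-> R} := HB.pack Z (isMeasurableFun.Build _ _ _ _ _ mZ).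
have ZZ' : same_law P ZR Z' by move=> A mA; rewrite Z'_law.
have [Z'2 Z'mean] := same_law_Lfun2 (measurable_funP Z') ZZ' Z2.
have Z'C : mean P ((Z' : Omega -> R) ^+ 2)%R <= 32 * beta ^+ 2 / k%:R.
  apply: le_trans ZC; rewrite le_eqVlt; apply/orP; left; apply/eqP.
  rewrite /mean unlock; congr fine; apply/esym.
  apply: (ge0_same_law_integral (X := ZR) (Y := Z') (h := fun x => (x ^+ 2)%:E)) => //.
  - by apply/measurable_EFinP; exact: exprn_measurable.
  - by move=> x; rewrite lee_fin sqr_ge0.
have /cvg_ex[m em] := is_cvg_mean_fchain nu_pos nu_decr nu_sum Y2 Ymean YB.
have Emean h : 'E_P[f \o chain g U x0 h%:Z 0]%E = (mean P (Y 0 h))%:E.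
  by rewrite -fchain0 meanE//; exact/Lfun21/Y2.
have Ecvg : 'E_P[f \o chain g U x0 h%:Z 0]%E @[h --> \oo] --> m%:E.
  under eq_fun do rewrite Emean; apply: cvg_EFin => //; exact: nearW.
have muE : mu = m%:E by exact/cvg_lim.
have Mge n : (n <= M n)%N by rewrite /M; have := ltn_expl n (ltnSn 1); nia.
have lvl_cvg : mean P (lvl n) @[n --> \oo] --> m.
  rewrite (_ : (fun n => _) = fun n => (k - b' k)%:R^-1 *
      \sum_(b' k <= i < k) mean P (Y 0 (i + M n)%N)).
    exact: cvg_mean_shift b'lt Mge em.
  by apply/funext => n; rewrite lvlE mean_block_avg.
have meanZ' : mean P Z' = m - mean P (lvl 0%N).
  rewrite -Z'mean; apply: (mean_single_term p_gt0 N_law D2 ND Z2).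
  rewrite (_ : (fun n => _) = fun n => mean P (lvl n) - mean P (lvl 0%N)).
    by apply: cvgB => //; exact: cvg_cst.
  (* The level differences telescope, so the correction has mean m minus the mean of level 0,
     exactly the bias to be removed. *)
  apply/funext => n; rewrite -(telescope_sumr (fun l => mean P (lvl l)) (leq0n n)).
  apply: eq_bigr => l _.
  by rewrite meanB//; exact: Lfun21.
have [F2 Fmean Fsd] := thinned_estimator q0 (lvl2 0%N) Z'2 Q_law Z'_indep Q_indep.
have htau' l := htau k l k_gt0.
have /andP[T0 T7] := Z_time_le nu_pos nu_decr nu_sum k_gt0 htau'.
have [z [zE z0 z7]] : exists z, [/\ Z_time p tau k = z%:E, 0 <= z & z <= 7 * k%:R].
  by move: T0 T7; case: (Z_time _ _ _) => // z; rewrite !lee_fin; exists z.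
have ThatE : That = (k%:R + q * z)%:E by rewrite /That /est_time zE.
have qz : q * z <= q * (7 * k%:R) by rewrite ler_wpM2l// ltW.
have fk2 : fk \in Lfun P 2%:E.
  by rewrite /fk /f_avg (time_avgE _ _ _ _ _ _ 0); exact: block_avg_Lfun2.
split.
- by rewrite muE; split => //; apply/cvg_ex; exists m%:E.
- exact: F2.
- by rewrite meanE ?Lfun21// Fmean meanZ' muE subrKC.
- by rewrite ThatE lee_fin; have := mulr_ge0 (ltW q0) (ltW K0); lra.
rewrite ThatE !varianceE_sd// -!EFinM -EFinD lee_fin.
have := sd_block_avg_drop nu_pos nu_sum Y2 Ystart YB YM bb' b'k k_gt0.
have -> : block_avg Y 0 (b' k) k = lvl 0%N by rewrite lvlE /M expn0 subnn muln0.
have -> : block_avg Y 0 (b k) k = fk by rewrite /fk /f_avg (time_avgE _ _ _ _ _ _ 0).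
rewrite -/B; set s := Num.sqrt _; set V0 := sd P (lvl 0%N) ^+ 2 => -[V0B V0k].
set VF := sd P fhat ^+ 2; have VF0 : 0 <= VF by exact: sqr_ge0.
(* As [beta] = q B, dividing the second moment by q still leaves a factor q. *)
have VFle : k%:R * VF <= k%:R * V0 + 32 * q * B ^+ 2.
  apply: (@le_trans _ _ (k%:R * (V0 + q^-1 * (32 * beta ^+ 2 / k%:R)))).
    rewrite ler_wpM2l// (le_trans Fsd)// lerD2l ler_wpM2l// invr_ge0 ltW//.
  rewrite qB le_eqVlt; apply/orP; left; apply/eqP; field.
  by rewrite !gt_eqF.
have mq : q <= Num.max q s by rewrite le_max lexx.
have ms : s <= Num.max q s by rewrite le_max lexx orbT.
have s0 : 0 <= s by exact: sqrtr_ge0.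
have B2 : 0 < B ^+ 2 by rewrite exprn_gt0.
move: (Num.max q s) mq ms => x qx sx.
set Vk := sd P fk ^+ 2 in V0k *.
apply: (@le_trans _ _ ((1 + 7 * q) * (k%:R * VF))).
  by rewrite mulrA ler_wpM2r//; lra.
apply: (@le_trans _ _ ((1 + 7 * q) * (k%:R * V0 + 32 * q * B ^+ 2))).
  by rewrite ler_wpM2l// addr_ge0// mulr_ge0// ltW.
(* Expanding the product, with q <= 1, the coefficients of q B^2 are 32 + 7 * 50 + 7 * 32 = 606 and
   that of s B^2 is 1000; their sum 1606 is well below 8610. *)
have h1 : q * (k%:R * V0) <= q * (50 * B ^+ 2) by rewrite ler_wpM2l// ltW.
have h2 : q * (q * B ^+ 2) <= 1 * (q * B ^+ 2) by rewrite ler_wpM2r// mulr_ge0// ltW.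
have h3 : B ^+ 2 * q <= B ^+ 2 * x by rewrite ler_pM2l.
have h4 : B ^+ 2 * s <= B ^+ 2 * x by rewrite ler_pM2l.
have h5 : 0 <= B ^+ 2 * x by rewrite mulr_ge0 ?(ltW B2) ?(le_trans s0).
lra.
Qed.
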